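(* Let $X$ be a centered Gaussian random variable in a separable Banach space $(E,\|\cdot\|)$ with dual $(E^*,\|\cdot\|_* )$. Suppose there are $c_0>0$, $\alpha>0$, $\beta\in\mathbb{R}$ such that $\mathbb{P}\{\|X\|\le\varepsilon\}\ge\exp\{-c_0\varepsilon^{-\alpha}|\log\varepsilon|^\beta\}$ for all sufficiently small $\varepsilon>0$. Let $\sigma^2=\sup_{\|g\|_*\le1}\mathbb{E}|g(X)|^2$. Then there exist constants $c_1,c_2>0$ depending only on $c_0,\alpha,\beta,\sigma$ such that for all sufficiently large $\lambda$, $$\mathbb{P}\{\|X\|>\lambda\}\le c_1\exp\Big\{-\frac{\lambda^2}{2\sigma^2}+c_2\lambda^{\frac{\alpha}{\alpha+1}}(\log\lambda)^{\frac{\beta}{\alpha+1}}\Big\}.$$ *)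

(* Defs.v *)
From HB Require Import structures.
From mathcomp Require Import all_boot all_order all_algebra.
From mathcomp Require Import all_classical all_reals all_analysis.
Set Implicit Arguments. Unset Strict Implicit. Unset Printing Implicit Defensive.
Import Order.TTheory GRing.Theory Num.Theory.
Import numFieldNormedType.Exports.
Local Open Scope classical_set_scope.
Local Open Scope ring_scope.

Definition separable_space (T : topologicalType) : Prop :=
  exists D : set T, countable D /\ closure D = setT.

Definition dual_elt (R : realType) (E : normedModType R) (g : E -> R) : Prop :=
  (forall (a : R) (x y : E), g (a *: x + y) = a * g x + g y) /\ continuous g.

Definition dual_norm_le1 (R : realType) (E : normedModType R) (g : E -> R) : Prop :=
  forall x : E, `|g x| <= `|x|.

Definition Borel_rv (R : realType) (d : measure_display) (Omega : measurableType d)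
  (E : normedModType R) (X : Omega -> E) : Prop :=
  forall U : set E, open U -> measurable (X @^-1` U).

Definition centered_gaussian_real (R : realType) (d : measure_display)
  (Omega : measurableType d) (P : probability Omega R) (Y : Omega -> R) : Prop :=
  (P (Y @^-1` [set 0]) = 1%E) \/
  (exists s : R, 0 < s /\
     forall A : set R, measurable A -> P (Y @^-1` A) = normal_prob 0 s A).

Definition centered_gaussian (R : realType) (d : measure_display)
  (Omega : measurableType d) (P : probability Omega R)
  (E : normedModType R) (X : Omega -> E) : Prop :=
  Borel_rv X /\
  forall g : E -> R, dual_elt g -> centered_gaussian_real P (g \o X).

Definition weak_variance (R : realType) (d : measure_display)
  (Omega : measurableType d) (P : probability Omega R)
  (E : normedModType R) (X : Omega -> E) : \bar R :=
  ereal_sup [set (\int[P]_w ((`|g (X w)| ^+ 2)%:E))%E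
            | g in [set g : E -> R | dual_elt g /\ dual_norm_le1 g]].

(* Main.v *)
(** The variables g(X), g in the dual of E, form a linear space of centered
    Gaussians. Suppose that N functionals within rho of a given one, for the
    metric of L2(P), are rho/2-separated. The Cameron-Martin shifts of
    {|X| <= eps} along suitable multiples of their differences with it are
    disjoint, and a shift costs only a factor exp(- O(eps^2 / rho^2)) in
    probability; so the small ball hypothesis bounds N, hence the L2 metric
    entropy of the unit dual ball (the easy half of the Kuelbs-Li duality).

    The tail is then estimated by chaining at the level of exponential moments.
    With theta = lambda / sigma^2, the union bound over the links of the chain is
    taken under the measures tilted by exp(theta xi), at the squared scales
    r / 4^k, k >= 0, where theta^2 r is of the order of the entropy at scale r.
    Then the entropy of the coarsest net and the whole chaining series are of the
    same order lambda^(alpha/(alpha+1)) (log lambda)^(beta/(alpha+1)), and the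
    leading term lambda^2 / (2 sigma^2) is left untouched.

    The Cameron-Martin formula is obtained without densities on E: joint
    exponential moments determine the expectations of products of smoothed
    indicators. *)

Require Import Defs.
From HB Require Import structures.
From mathcomp Require Import all_boot all_order all_algebra.
From mathcomp Require Import all_classical all_reals all_analysis.
From mathcomp Require Import measurable_realfun normal_distribution.
From mathcomp Require Import ring lra.
Set Implicit Arguments. Unset Strict Implicit. Unset Printing Implicit Defensive.
Import Order.TTheory GRing.Theory Num.Theory.
Import numFieldNormedType.Exports.
Local Open Scope classical_set_scope.
Local Open Scope ring_scope.

(** Three constraints shape the argument. The hypothesis gives only the law of each g(X) separately,
    so joint laws are reached through linear combinations, that is, through joint exponential
    moments. The leading term must be exact. For this each link of a chain starting at xi is
    recentred by its covariance with xi, under the measure tilted by xi; what is left for an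
    endpoint eta is cov(xi, eta) - var(xi) / 2, which is at most var(eta) / 2, so replacing eta by a
    net point costs nothing at order theta^2. The constants are fixed before the space and X, while
    the threshold below which the small ball bound holds depends on X, and the finite families of
    functionals have unbounded size. Radii above the threshold are therefore cut down to a fixed
    one: this adds a constant at each of O(log lambda) coarse levels and is absorbed once lambda is
    large. The size of the family disappears because the entropy grows by a factor less than 4
    whenever the squared scale is divided by 4, which leaves room for geometric weights making the
    whole series converge. *)

Section normal_moments.
Context {R : realType}.
Implicit Types (m s t x u k : R).
Local Notation mu := (@lebesgue_measure R).

Lemma ge0_integral_normal_prob m s (f : R -> \bar R) :
  measurable_fun setT f -> (forall x, 0 <= f x)%E ->
  (\int[normal_prob m s]_x f x =
   \int[mu]_x (f x * (normal_pdf m s x)%:E))%E.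
Proof.
move=> mf f0.
have dom : normal_prob m s `<< mu by exact: normal_prob_dominates.
rewrite -(Radon_Nikodym_SigmaFinite.change_of_variables dom)//.
apply: ae_eq_integral => //.
- apply: emeasurable_funM => //.
  exact: measurable_int (Radon_Nikodym_SigmaFinite.f_integrable dom).
- apply: emeasurable_funM => //.
  by apply/measurable_EFinP; exact: measurable_normal_pdf.
- apply: ae_eqe_mul2l => /=.
  apply: integral_ae_eq => //=.
  + exact: Radon_Nikodym_SigmaFinite.f_integrable.
  + by apply/measurable_EFinP; exact: measurable_normal_pdf.
  + by move=> E _ mE; rewrite -Radon_Nikodym_SigmaFinite.f_integral.
Qed.

Lemma integral_expR_normal s u : 0 < s ->
  (\int[normal_prob 0 s]_x (expR (u * x))%:E = (expR (u ^+ 2 * s ^+ 2 / 2))%:E)%E.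
Proof.
move=> s0.
rewrite ge0_integral_normal_prob//; last first.
  by apply/measurable_EFinP; apply: measurableT_comp => //; exact: measurable_funM.
transitivity (\int[mu]_x ((expR (u ^+ 2 * s ^+ 2 / 2))%:E * (normal_pdf (u * s ^+ 2) s x)%:E))%E.
  apply: eq_integral => x _; rewrite -!EFinM; congr EFin.
  rewrite !normal_pdfE ?gt_eqF// /normal_fun mulrCA [RHS]mulrCA -!expRD.
  congr (_ * expR _); rewrite subr0; field; exact: lt0r_neq0.
rewrite ge0_integralZl//.
- by rewrite integral_normal_pdf mule1.
- by apply/measurable_EFinP; exact: measurable_normal_pdf.
- by move=> x _; rewrite lee_fin normal_pdf_ge0.
Qed.

(** The exponent is a difference of two precisions: it turns the density of standard deviation [s]
    into [t / s] times the density of standard deviation [t]. *)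
Lemma integral_expR_sqr_normal m s t : 0 < s -> 0 < t ->
  (\int[normal_prob m s]_x
     (expR ((1 / (s ^+ 2 *+ 2) - 1 / (t ^+ 2 *+ 2)) * (x - m) ^+ 2))%:E
   = (t / s)%:E)%E.
Proof.
move=> s0 t0.
rewrite ge0_integral_normal_prob//; last first.
  apply/measurable_EFinP; apply: measurableT_comp => //.
  by apply: measurable_funM => //; apply: measurable_funX; exact: measurable_funB.
transitivity (\int[mu]_x ((t / s)%:E * (normal_pdf m t x)%:E))%E.
  apply: eq_integral => x _; rewrite -!EFinM; congr EFin.
  rewrite !normal_pdfE ?gt_eqF// /normal_fun mulrCA -expRD [RHS]mulrA.
  congr (_ * expR _); last first.
    by field; rewrite !lt0r_neq0.
  rewrite /normal_peak -!mulrnAr (sqrtrM _ (sqr_ge0 s)) (sqrtrM _ (sqr_ge0 t)) !sqrtr_sqr !gtr0_norm//.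
  have : Num.sqrt (pi *+ 2) != 0 :> R by rewrite sqrtr_eq0 -ltNge pmulrn_lgt0// pi_gt0.
  by move=> h; field; rewrite h !lt0r_neq0.
rewrite ge0_integralZl//.
- by rewrite integral_normal_pdf mule1.
- by apply/measurable_EFinP; exact: measurable_normal_pdf.
- by move=> x _; rewrite lee_fin normal_pdf_ge0.
- by rewrite lee_fin divr_ge0// ltW.
Qed.

Lemma normal_prob_tail_le m s (D : R) (A : set R) : 0 < s -> 0 < D ->
  measurable A -> (forall x, A x -> D <= `|x - m|) ->
  (normal_prob m s A <= (6 * s ^+ 2 / D ^+ 2)%:E)%E.
Proof.
move=> s0 D0 mA AD.
have s2 : 0 < s ^+ 2 by rewrite exprn_gt0.
have D2 : 0 < D ^+ 2 by rewrite exprn_gt0.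
(* Standard deviation [2 * s] makes the integral of exp(k (x - m)^2) equal to 2; with y <= exp(y)
   this is a Chebyshev bound with constant 16/3, rounded up to 6. *)
pose k := 1 / (s ^+ 2 *+ 2) - 1 / ((2 * s) ^+ 2 *+ 2).
have kE : k = 3 / (8 * s ^+ 2) by rewrite /k; field; exact: lt0r_neq0.
have k0 : 0 < k by rewrite kE divr_gt0// mulr_gt0.
have me : measurable_fun setT (fun x : R => expR (k * (x - m) ^+ 2)).
  apply: measurableT_comp => //; apply: measurable_funM => //.
  by apply: measurable_funX; exact: measurable_funB.
rewrite -[X in (X <= _)%E]mul1e -integral_cst//.
apply: (@le_trans _ _ (\int[normal_prob m s]_(x in A)
   ((k * D ^+ 2)^-1 * expR (k * (x - m) ^+ 2))%:E)%E).
  apply: ge0_le_integral => //.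
  - apply/measurable_EFinP; apply: measurable_funTS; exact: measurable_funM.
  - move=> x /AD Dx; rewrite lee_fin mulrC ler_pdivlMr ?mulr_gt0// mul1r.
    rewrite (le_trans _ (expR_ge1Dx _))// -[leLHS]add0r lerD// (ler_wpM2l (ltW k0))//.
    rewrite -[leRHS]ger0_norm ?sqr_ge0// normrX lerXn2r// ?nnegrE//.
    exact: ltW.
apply: (@le_trans _ _ (\int[normal_prob m s]_x
   ((k * D ^+ 2)^-1 * expR (k * (x - m) ^+ 2))%:E)%E).
  apply: ge0_subset_integral => //.
  - by apply/measurable_EFinP; exact: measurable_funM.
  - by move=> x _; rewrite lee_fin mulr_ge0 ?expR_ge0// invr_ge0 mulr_ge0 ?ltW.
under eq_integral do rewrite EFinM.
rewrite ge0_integralZl//; last 2 first.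
- exact/measurable_EFinP.
- by rewrite lee_fin invr_ge0 mulr_ge0 ?ltW.
- rewrite integral_expR_sqr_normal ?mulr_gt0// -EFinM lee_fin kE.
  rewrite (_ : (3 / (8 * s ^+ 2) * D ^+ 2)^-1 * (2 * s / s) = (16 / 3) * (s ^+ 2 / D ^+ 2)); last first.
    by field; rewrite !lt0r_neq0.
  rewrite (_ : 6 * s ^+ 2 / D ^+ 2 = 6 * (s ^+ 2 / D ^+ 2)); last by ring.
  by rewrite ler_wpM2r ?divr_ge0 ?ltW//; lra.
Qed.

(** The inequality 1 + k x^2 <= exp(k x^2) is integrated for [k] of both signs; its right side has
    integral [r] when k = (r^2 - 1) / (2 r^2 s^2). Letting [r] tend to 1 from above and from below
    squeezes the second moment to [s ^+ 2]. *)
Lemma integral_sqr_normal s : 0 < s ->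
  (\int[normal_prob 0 s]_x (x ^+ 2)%:E = (s ^+ 2)%:E)%E.
Proof.
move=> s0.
have mq (k : R) : measurable_fun [set: R] (fun x : R => k * x ^+ 2).
  by apply: measurable_funM => //; exact: measurable_funX.
have me (k : R) : measurable_fun [set: R] (fun x : R => expR (k * x ^+ 2)).
  by apply: measurableT_comp => //; exact: mq.
have msq : measurable_fun [set: R] (fun x : R => x ^+ 2) by exact: measurable_funX.
set A := (X in X = _).
have A0 : (0 <= A)%E by apply: integral_ge0 => x _; rewrite lee_fin sqr_ge0.
pose k (r : R) := 1 / (s ^+ 2 *+ 2) - 1 / ((r * s) ^+ 2 *+ 2).
have kE r : 0 < r -> k r = (r ^+ 2 - 1) / (2 * r ^+ 2 * s ^+ 2).
  by move=> r0; rewrite /k; field; rewrite !lt0r_neq0.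
have E r : 0 < r -> (\int[normal_prob 0 s]_x (expR (k r * x ^+ 2))%:E = r%:E)%E.
  move=> r0; rewrite -[in RHS](mulfK (lt0r_neq0 s0) r).
  rewrite -(integral_expR_sqr_normal 0 s0 (mulr_gt0 r0 s0)).
  by apply: eq_integral => x _; rewrite subr0.
have up r : 1 < r -> (1 + (k r)%:E * A <= r%:E)%E.
  move=> r1; have r0 : 0 < r by lra.
  have k0 : 0 <= k r.
    rewrite kE//; apply: divr_ge0; last by apply: mulr_ge0; [apply: mulr_ge0|]; rewrite ?sqr_ge0.
    by rewrite subr_ge0 expr_ge1 ?ltW.
  rewrite -(E _ r0) -ge0_integralZl//; last 2 first.
  - by apply/measurable_EFinP.
  - by move=> x _; rewrite lee_fin sqr_ge0.
  have -> : (1 = \int[normal_prob 0 s]_x (cst 1%E x))%E.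
    by rewrite integral_cst//= probability_setT mul1e.
  rewrite -ge0_integralD//; last 2 first.
  - by move=> x _; rewrite -EFinM lee_fin mulr_ge0// sqr_ge0.
  - by apply: measurable_funeM; exact/measurable_EFinP.
  apply: ge0_le_integral => //.
  - by move=> x _; rewrite /= -EFinM -EFinD lee_fin addr_ge0// mulr_ge0// sqr_ge0.
  - by apply: emeasurable_funD => //; apply: measurable_funeM; exact/measurable_EFinP.
  - apply/measurable_EFinP; exact: me.
  - by move=> x _; rewrite /= -EFinM -EFinD lee_fin expR_ge1Dx.
have down r : 0 < r -> r < 1 -> (1 <= r%:E + (- k r)%:E * A)%E.
  move=> r0 r1.
  have k0 : 0 <= - k r.
    rewrite kE// -mulNr opprB; apply: divr_ge0; last by apply: mulr_ge0; [apply: mulr_ge0|]; rewrite ?sqr_ge0.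
    by rewrite subr_ge0 exprn_ile1 ?ltW.
  rewrite -(E _ r0) -ge0_integralZl//; last 2 first.
  - by apply/measurable_EFinP.
  - by move=> x _; rewrite lee_fin sqr_ge0.
  have -> : (1 = \int[normal_prob 0 s]_x (cst 1%E x))%E.
    by rewrite integral_cst//= probability_setT mul1e.
  rewrite -ge0_integralD//; last 3 first.
  - apply/measurable_EFinP; exact: me.
  - by move=> x _; rewrite -EFinM lee_fin mulr_ge0// sqr_ge0.
  - by apply: measurable_funeM; exact/measurable_EFinP.
  apply: ge0_le_integral => //.
  - by apply: emeasurable_funD; [apply/measurable_EFinP; exact: me|apply: measurable_funeM; exact/measurable_EFinP].
  - move=> x _; rewrite /= -EFinM -EFinD lee_fin mulNr -lerBlDr opprK.
    exact: expR_ge1Dx.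
have s20 : 0 < s ^+ 2 by rewrite exprn_gt0.
have Afin : (A < +oo)%E.
  rewrite ltey; apply/eqP => Ay.
  have k2 : 0 < k 2.
    rewrite kE// divr_gt0//; first by rewrite subr_gt0 exprn_egt1// ltr1n.
    by rewrite mulr_gt0// mulr_gt0// exprn_gt0.
  by have := up 2 ltac:(lra); rewrite Ay gt0_muley ?lte_fin// addey.
have {A0} Af : A \is a fin_num by rewrite ge0_fin_numE.
clearbody A; rewrite -(fineK Af) in up down *; congr EFin; set a := fine A in up down *.
clearbody a k; clear E Afin Af.
apply/eqP; rewrite eq_le; apply/andP; split.
- apply/ler_addgt0Pl => e e0.
  pose h := e / (2 * s ^+ 2); have h0 : 0 < h by rewrite divr_gt0// mulr_gt0.
  have := up (1 + h) ltac:(lra); rewrite -EFinM -EFinD lee_fin kE; last lra.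
  have h10 : 1 + h != 0 by rewrite gt_eqF//; lra.
  have -> : ((1 + h) ^+ 2 - 1) / (2 * (1 + h) ^+ 2 * s ^+ 2) * a =
    h * (a * (2 + h) / (2 * (1 + h) ^+ 2 * s ^+ 2)).
    by field; rewrite gt_eqF// h10.
  rewrite lerD2l ger_pMr// ler_pdivrMr; last first.
    by apply: mulr_gt0 => //; apply: mulr_gt0 => //; apply: exprn_gt0; lra.
  have -> : e = 2 * h * s ^+ 2 by rewrite /h; field; rewrite gt_eqF.
  rewrite mul1r => H; rewrite -(ler_pM2r (_ : 0 < 2 + h)); last lra.
  apply: (le_trans H); have -> : (2 * h * s ^+ 2 + s ^+ 2) * (2 + h) =
    2 * (1 + h) ^+ 2 * s ^+ 2 + h * s ^+ 2 by ring.
  by rewrite lerDl mulr_ge0// ltW.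
- apply/ler_addgt0Pl => e e0.
  pose h := Num.min (1/2) (e / (2 * s ^+ 2)).
  have h0 : 0 < h by rewrite lt_min; apply/andP; split; [lra|rewrite divr_gt0// mulr_gt0].
  have h1 : h <= 1/2 by rewrite ge_min lexx.
  have he : h * (2 * s ^+ 2) <= e by rewrite -ler_pdivlMr ?mulr_gt0// ge_min lexx orbT.
  have := down (1 - h) ltac:(lra) ltac:(lra); rewrite -EFinM -EFinD lee_fin kE; last lra.
  have h10 : 1 - h != 0 by rewrite gt_eqF//; lra.
  have -> : - (((1 - h) ^+ 2 - 1) / (2 * (1 - h) ^+ 2 * s ^+ 2)) * a =
    h * (a * (2 - h) / (2 * (1 - h) ^+ 2 * s ^+ 2)).
    by field; rewrite gt_eqF// h10.
  set q := _ / _ => H; have {H} q1 : 1 <= q by rewrite -(ler_pM2l h0); lra.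
  move: q1; rewrite ler_pdivlMr; last first.
    by apply: mulr_gt0 => //; apply: mulr_gt0 => //; apply: exprn_gt0; lra.
  rewrite mul1r => H; rewrite -(ler_pM2r (_ : 0 < 2 - h)); last lra.
  have : 0 <= h * s ^+ 2 by rewrite mulr_ge0// ltW.
  have : (h * (2 * s ^+ 2)) * (2 - h) <= e * (2 - h) by rewrite ler_pM2r//; lra.
  have -> : h * (2 * s ^+ 2) * (2 - h) = 4 * (h * s ^+ 2) - 2 * (h ^+ 2 * s ^+ 2) by ring.
  move: H; have -> : 2 * (1 - h) ^+ 2 * s ^+ 2 = 2 * s ^+ 2 - 4 * (h * s ^+ 2) + 2 * (h ^+ 2 * s ^+ 2) by ring.
  lra.
Qed.

End normal_moments.

Section centered_gaussian_real_moments.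
Context {R : realType} {d : measure_display} {Omega : measurableType d}.
Context (P : probability Omega R).
Implicit Types (Y : Omega -> R).

Definition variance2 Y : R := fine (\int[P]_w (Y w ^+ 2)%:E)%E.

Lemma centered_gaussian_real_integral Y : measurable_fun setT Y ->
  centered_gaussian_real P Y ->
  exists2 s : R, 0 <= s & forall f : R -> R, measurable_fun setT f ->
    (forall x, 0 <= f x) ->
    (\int[P]_w (f (Y w))%:E = if s == 0%R then (f 0)%:E
                              else \int[normal_prob 0 s]_x (f x)%:E)%E.
Proof.
move=> mY [P0|[s [s0 law]]].
- exists 0 => // f mf f0; rewrite eqxx.
  have mY0 : measurable (Y @^-1` [set 0]) by rewrite -[X in measurable X]setTI; exact: mY.
  rewrite (ae_eq_integral (cst (f 0)%:E))//.
  + by rewrite integral_cst//= probability_setT mule1.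
  + by apply/measurable_EFinP; exact: measurableT_comp.
  + exists (~` (Y @^-1` [set 0])); split; first exact: measurableC.
      by have := probability_setC P mY0; rewrite P0 subee.
    by apply: subsetC => w /= Yw _ /=; rewrite Yw.
- exists s => [|f mf f0]; first exact: ltW.
  rewrite gt_eqF//.
  have mY' : measurable_fun setT (Y : Omega -> measurableTypeR R) by exact: mY.
  pose Y' : {mfun Omega >-> measurableTypeR R} :=
    HB.pack (Y : Omega -> measurableTypeR R)
      (isMeasurableFun.Build _ _ _ _ (Y : Omega -> measurableTypeR R) mY').
  transitivity (\int[distribution P Y']_x (f x)%:E)%E.
    rewrite ge0_integral_distribution//; exact/measurable_EFinP.
  by apply: eq_measure_integral => A mA _; exact: law.
Qed.

Lemma centered_gaussian_real_moments Y : measurable_fun setT Y ->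
  centered_gaussian_real P Y ->
  [/\ (\int[P]_w (Y w ^+ 2)%:E = (variance2 Y)%:E)%E,
      forall u : R, (\int[P]_w (expR (u * Y w))%:E = (expR (u ^+ 2 * variance2 Y / 2))%:E)%E &
      forall k : R, 4 * k * variance2 Y <= 1 ->
        (\int[P]_w (expR (k * Y w ^+ 2))%:E < +oo)%E].
Proof.
move=> mY /(centered_gaussian_real_integral mY)[s s0 E].
have msq : measurable_fun setT (fun x : R => x ^+ 2) by exact: measurable_funX.
have me (u : R) : measurable_fun setT (fun x : R => expR (u * x)).
  by apply: measurableT_comp => //; exact: measurable_funM.
have mq (u : R) : measurable_fun setT (fun x : R => expR (u * x ^+ 2)).
  by apply: measurableT_comp => //; exact: measurable_funM.
have sq : (\int[P]_w (Y w ^+ 2)%:E = (s ^+ 2)%:E)%E.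
  rewrite (E (fun x => x ^+ 2))//; last by move=> x; rewrite sqr_ge0.
  by case: eqP => [->|/eqP sN0]//; rewrite integral_sqr_normal// lt0r sN0.
have v : variance2 Y = s ^+ 2 by rewrite /variance2 sq.
rewrite v; split => // [u|k].
- rewrite (E (fun x => expR (u * x)))//.
  case: eqP => [->|/eqP sN0].
    by rewrite expr0n/= !mulr0 mul0r.
  by rewrite integral_expR_normal// lt0r sN0.
- rewrite (E (fun x => expR (k * x ^+ 2)))//.
  case: eqP => [->|/eqP sN0]; first by rewrite ltry.
  have {s0 sN0}s0 : 0 < s by rewrite lt0r sN0.
  move=> ks.
  have s2 : 0 < s ^+ 2 by rewrite exprn_gt0.
  have h : 0 < s ^- 2 - 2 * k.
    rewrite subr_gt0 -(ltr_pM2r s2) mulVf ?gt_eqF//.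
    lra.
  (* [t] solves 1/s^2 - 1/t^2 = 2 k, which is the form integrated by [integral_expR_sqr_normal]. *)
  pose t := Num.sqrt (s ^- 2 - 2 * k)^-1.
  have t0 : 0 < t by rewrite sqrtr_gt0 invr_gt0.
  have t2 : t ^+ 2 = (s ^- 2 - 2 * k)^-1 by rewrite sqr_sqrtr// invr_ge0 ltW.
  have -> : k = 1 / (s ^+ 2 *+ 2) - 1 / (t ^+ 2 *+ 2).
    have e1 (x : R) : 1 / (x *+ 2) = x^-1 / 2 by rewrite div1r -(mulr_natr x 2) invfM.
    rewrite !e1 t2 invrK; move: (s ^- 2) => a; lra.
  have := integral_expR_sqr_normal 0 s0 t0.
  by under eq_integral do rewrite subr0; move=> ->; rewrite ltry.
Qed.

End centered_gaussian_real_moments.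

(** * From exponential moments to Gaussian weights *)

Section exponential_transform.
Context {R : realType}.

Lemma bernoulli_le (q : R) n : 1 <= q -> 1 + n%:R * (q - 1) <= q ^+ n.
Proof.
move=> q1; elim: n => [|n IH]; first by rewrite mul0r addr0 expr0.
have := ler_wpM2l (le_trans ler01 q1) IH; rewrite -exprS.
have := mulr_ge0 (ler0n R n) (sqr_ge0 (q - 1)).
rewrite -[n.+1]addn1 natrD; move: (n%:R) => u; nra.
Qed.

Lemma expR_sub1_bounds (t : R) : `|t| <= 1 / 2 ->
  (t <= expR t - 1) /\ (`|expR t - 1| <= 2 * `|t|).
Proof.
rewrite ler_norml => /andP[ta tb].
have l : 1 + t <= expR t by exact: expR_ge1Dx.
have u : expR t * (1 - t) <= 1.
  rewrite -[leRHS](mulfV (lt0r_neq0 (expR_gt0 t))) -expRN.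
  by rewrite ler_pM2l ?expR_gt0//; have := expR_ge1Dx (- t).
split; first lra.
have [t0|t0] := leP 0 t.
  rewrite (ger0_norm t0) ger0_norm; nra.
rewrite (ltr0_norm t0) ler0_norm; nra.
Qed.

(** Since 2 e^t - e^(2t) = 1 - (e^t - 1)^2, this bounds the modulus of 2 e^t - e^(2t) by exp(4 t^2)
    for all real [t]. At t = c / n the n^2-th power stays below exp(4 c^2) for every n: this is the
    domination needed to integrate the limit [cvg_expR_sqr]. *)
Lemma sqr_expR_sub1_le (t : R) : 1 + (expR t - 1) ^+ 2 <= expR (4 * t ^+ 2).
Proof.
have [tl|tg] := ltP t (- (1/2)).
  have e0 := expR_gt0 t; have e1 : expR t <= 1 by rewrite expR_le1; lra.
  have : expR 1 <= expR (4 * t ^+ 2) by rewrite ler_expR; nra.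
  have : 1 + 1 <= expR 1 :> R by exact: expR_ge1Dx.
  nra.
have [tl|tb] := ltP (1/2) t.
  have e1 : 1 <= expR t by rewrite -expR0 ler_expR; lra.
  have : expR (t + t) <= expR (4 * t ^+ 2) by rewrite ler_expR; nra.
  rewrite expRD; nra.
have [_ u] : (t <= expR t - 1) /\ (`|expR t - 1| <= 2 * `|t|).
  by apply: expR_sub1_bounds; rewrite ler_norml tg.
apply: le_trans (expR_ge1Dx _).
rewrite lerD2l.
have -> : 4 * t ^+ 2 = (2 * `|t|) ^+ 2 by rewrite exprMn -normrX ger0_norm ?sqr_ge0//; ring.
by rewrite -[leLHS]ger0_norm ?sqr_ge0// normrX lerXn2r// ?nnegrE// mulr_ge0.
Qed.

Lemma normr_subXX_le (a b : R) n : `|a| <= 1 -> `|b| <= 1 ->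
  `|a ^+ n - b ^+ n| <= n%:R * `|a - b|.
Proof.
move=> a1 b1; elim: n => [|n IH]; first by rewrite !expr0 subrr normr0 mul0r.
have -> : a ^+ n.+1 - b ^+ n.+1 = a * (a ^+ n - b ^+ n) + (a - b) * b ^+ n.
  by rewrite !exprS; ring.
rewrite (le_trans (ler_normD _ _))// -[n.+1]addn1 natrD [leRHS]mulrDl mul1r lerD//.
- by rewrite normrM (le_trans _ IH)// ler_piMl.
- by rewrite normrM ler_piMr// normrX exprn_ile1.
Qed.

(* Turns the Gaussian weight exp(- Y^2) into a limit of polynomials in exp(t Y),
   whose integrals are given by exponential moments. *)
Lemma cvg_expR_sqr (c : R) :
  (fun m : nat => (2 * expR (c / m.+1%:R) - expR (2 * (c / m.+1%:R))) ^+ (m.+1 ^ 2))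
    @ \oo --> expR (- c ^+ 2).
Proof.
apply/cvgrPdist_le => e e0; near=> m.
set t := c / m.+1%:R.
have m0 : 0 < m.+1%:R :> R by [].
have tE : `|t| = `|c| / m.+1%:R by rewrite /t normrM normfV (gtr0_norm m0).
have t4 : `|t| <= 1 / 4.
  rewrite tE ler_pdivrMr//.
  have : 4 * `|c| <= m%:R by near: m; exact: nbhs_infty_ger.
  by rewrite -[m.+1]addn1 natrD; lra.
have [x1 x2] : (t <= expR t - 1) /\ (`|expR t - 1| <= 2 * `|t|).
  by apply: expR_sub1_bounds; lra.
have ux : (expR t - 1) * (1 - t) <= t.
  have : expR t * (1 - t) <= 1.
    rewrite -[leRHS](mulfV (lt0r_neq0 (expR_gt0 t))) -expRN.
    by rewrite ler_pM2l ?expR_gt0//; have := expR_ge1Dx (- t).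
  lra.
(* Both sides are now powers of order (m + 1)^2 of numbers of modulus at most 1, so their distance
   is at most (m + 1)^2 times that of the bases. The bases differ by O(|t|^3) with t = c / (m + 1),
   which gives O(1 / (m + 1)). *)
have -> : expR (- c ^+ 2) = expR (- t ^+ 2) ^+ (m.+1 ^ 2).
  rewrite -expRM_natl natrX; congr expR; rewrite /t; field; exact: lt0r_neq0.
have -> : 2 * expR t - expR (2 * t) = 1 - (expR t - 1) ^+ 2.
  by rewrite expRM_natl; ring.
set x := expR t - 1 in x1 x2 ux *.
have x2t : x ^+ 2 <= 4 * `|t| ^+ 2.
  have -> : 4 * `|t| ^+ 2 = (2 * `|t|) ^+ 2 by ring.
  by rewrite -[leLHS]ger0_norm ?sqr_ge0// normrX lerXn2r// ?nnegrE// mulr_ge0.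
have a1 : `|1 - x ^+ 2| <= 1.
  have := sqr_ge0 x; rewrite ler_norml; have := normr_ge0 t; nra.
have b1 : `|expR (- t ^+ 2)| <= 1.
  by rewrite ger0_norm ?expR_ge0// expR_le1 oppr_le0 sqr_ge0.
rewrite distrC (le_trans (normr_subXX_le _ a1 b1))//.
have s1 : 1 - t ^+ 2 <= expR (- t ^+ 2) by exact: expR_ge1Dx.
have s2 : expR (- t ^+ 2) <= 1 - t ^+ 2 + t ^+ 4.
  have : 1 + t ^+ 2 <= expR (t ^+ 2) by exact: expR_ge1Dx.
  rewrite expRN => h; rewrite invf_ple ?posrE ?expR_gt0//; last first.
    have := normr_ge0 t; have -> : t ^+ 4 = (t ^+ 2) ^+ 2 by ring.
    have := real_normK (num_real t); nra.
  apply: le_trans h; rewrite -[leLHS]mul1r ler_pdivrMr; last first.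
    have -> : t ^+ 4 = (t ^+ 2) ^+ 2 by ring.
    have := real_normK (num_real t); have := normr_ge0 t; nra.
  have -> : t ^+ 4 = (t ^+ 2) ^+ 2 by ring.
  have := sqr_ge0 t; move: (t ^+ 2) => q q0; have : 0 <= q ^+ 3 by exact: exprn_ge0.
  by rewrite !exprS expr0; nra.
have d1 : `|1 - x ^+ 2 - expR (- t ^+ 2)| <= 7 * `|t| ^+ 3.
  have t2 := real_normK (num_real t).
  have -> : 1 - x ^+ 2 - expR (- t ^+ 2) =
    (t - x) * (t + x) + (1 - t ^+ 2 - expR (- t ^+ 2)) by ring.
  have xt : x - t <= 2 * `|t| ^+ 2.
    have : x * t <= `|x| * `|t| by rewrite -normrM ler_norm.
    have : `|x| * `|t| <= 2 * `|t| * `|t| by rewrite ler_wpM2r.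
    lra.
  have xt3 : `|t + x| <= 3 * `|t| by rewrite (le_trans (ler_normD _ _))//; lra.
  rewrite (le_trans (ler_normD _ _))// normrM.
  have -> : 7 * `|t| ^+ 3 = 2 * `|t| ^+ 2 * (3 * `|t|) + `|t| ^+ 3 by ring.
  apply: lerD.
    by apply: ler_pM => //; rewrite distrC ger0_norm// subr_ge0.
  rewrite ler0_norm; last lra.
  have : t ^+ 4 <= `|t| ^+ 3; last lra.
  have -> : t ^+ 4 = `|t| ^+ 3 * `|t| by rewrite -exprSr -[t ^+ 4]/(t ^+ (2 * 2)) exprM -t2 -exprM.
  by rewrite ler_piMr ?exprn_ge0//; lra.
rewrite (le_trans (ler_wpM2l _ d1))//.
have -> : (m.+1 ^ 2)%:R * (7 * `|t| ^+ 3) = 7 * `|c| ^+ 3 / m.+1%:R.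
  rewrite tE natrX; field; exact: lt0r_neq0.
rewrite ler_pdivrMr// [e * _]mulrC -ler_pdivrMr//.
have : 7 * `|c| ^+ 3 / e <= m%:R by near: m; exact: nbhs_infty_ger.
by move/le_trans; apply; rewrite ler_nat.
Unshelve. all: by end_near. Qed.

End exponential_transform.

Section exponential_moments_determine.
Context {R : realType} {d : measure_display} {Omega : measurableType d}.
Context (mu : {measure set Omega -> \bar R}).
Implicit Types (Y h : Omega -> R).

Lemma measurable_weighted_expR h Y (u : R) (a : R) :
  measurable_fun setT h -> measurable_fun setT Y ->
  measurable_fun setT (fun w => h w * expR (u * Y w + a * Y w ^+ 2)).
Proof.
move=> mh mY; apply: measurable_funM => //; apply: measurableT_comp => //.
by apply: measurable_funD; apply: measurable_funM => //; exact: measurable_funX.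
Qed.

Lemma weighted_expR_integrable h Y (a u : R) :
  measurable_fun setT h -> measurable_fun setT Y -> (forall w, 0 <= h w) ->
  0 <= a ->
  (\int[mu]_w (h w * expR (u * Y w + a * Y w ^+ 2))%:E < +oo)%E ->
  mu.-integrable setT (fun w => (h w * expR (u * Y w))%:E).
Proof.
move=> mh mY h0 a0 fin; apply/integrableP; split.
  apply/measurable_EFinP; apply: measurable_funM => //.
  by apply: measurableT_comp => //; exact: measurable_funM.
apply: le_lt_trans fin; apply: ge0_le_integral => //.
- apply/measurableT_comp => //; apply/measurable_EFinP; apply: measurable_funM => //.
  by apply: measurableT_comp => //; exact: measurable_funM.
- by apply/measurable_EFinP; exact: measurable_weighted_expR.
- move=> w _; rewrite /= lee_fin ger0_norm ?mulr_ge0 ?expR_ge0// ler_wpM2l//.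
  by rewrite ler_expR lerDl mulr_ge0// sqr_ge0.
Qed.

Lemma integrable_double_sub (f1 f2 : Omega -> \bar R) :
  mu.-integrable setT f1 -> mu.-integrable setT f2 ->
  mu.-integrable setT (fun w => 2%:E * f1 w - f2 w)%E /\
  (\int[mu]_w (2%:E * f1 w - f2 w) = 2%:E * \int[mu]_w f1 w - \int[mu]_w f2 w)%E.
Proof.
move=> i1 i2; have i1' : mu.-integrable setT (fun w => 2%:E * f1 w)%E by exact: integrableZl.
split; first exact: (integrableB measurableT i1' i2).
by rewrite (integralB measurableT i1' i2) integralZl.
Qed.

Definition expR_poly (g Z : Omega -> R) (t : R) n (u : R) : Omega -> \bar R :=
  fun w => (g w * expR (u * Z w) *
    (2 * expR (t * Z w) - expR (2 * (t * Z w))) ^+ n)%:E.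

Lemma expR_polyS g Z t n u : expR_poly g Z t n.+1 u =
  (fun w => 2%:E * expR_poly g Z t n (u + t) w - expR_poly g Z t n (u + 2 * t) w)%E.
Proof.
apply/funext => w; rewrite /expR_poly -EFinM -EFinB; congr EFin.
have -> : (u + t) * Z w = u * Z w + t * Z w by ring.
have -> : (u + 2 * t) * Z w = u * Z w + 2 * (t * Z w) by ring.
by rewrite !expRD exprS; ring.
Qed.

(** A factor 2 e^(tY) - e^(2tY) only shifts [u] by [t] or by [2 * t], so an induction on [n] with
    [u] kept general replaces the binomial expansion. *)
Lemma expR_poly_integral h h' Y Y' (t : R) n :
  (forall u : R, mu.-integrable setT (fun w => (h w * expR (u * Y w))%:E)) ->
  (forall u : R, mu.-integrable setT (fun w => (h' w * expR (u * Y' w))%:E)) ->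
  (forall u : R, (\int[mu]_w (h w * expR (u * Y w))%:E =
                  \int[mu]_w (h' w * expR (u * Y' w))%:E)%E) ->
  forall u : R,
  [/\ mu.-integrable setT (expR_poly h Y t n u),
      mu.-integrable setT (expR_poly h' Y' t n u) &
      (\int[mu]_w expR_poly h Y t n u w = \int[mu]_w expR_poly h' Y' t n u w)%E].
Proof.
move=> I I' E; elim: n => [|n IH] u.
  have D g Z : expR_poly g Z t 0 u = (fun w => (g w * expR (u * Z w))%:E).
    by apply/funext => w; rewrite /expR_poly expr0 mulr1.
  by rewrite (D h Y) (D h' Y').
have [I1 I1' E1] := IH (u + t); have [I2 I2' E2] := IH (u + 2 * t).
have [J EJ] := integrable_double_sub I1 I2.
have [J' EJ'] := integrable_double_sub I1' I2'.
rewrite (expR_polyS h Y) (expR_polyS h' Y'); split; [exact: J|exact: J'|].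
apply: (etrans EJ); apply: esym; apply: (etrans EJ').
exact: (congr2 (fun a b : \bar R => 2%:E * a - b)%E (esym E1) (esym E2)).
Qed.

(** The pairs ([h], [Y]) and ([h'], [Y']) will be the two sides of the Cameron-Martin formula:
    equality of weighted exponential moments survives multiplication of the weights by exp(- a^2
    Y^2). The proof is dominated convergence of [expR_poly]; the factor exp(4 a^2 Y^2) in the
    hypotheses is the dominating one given by [sqr_expR_sub1_le]. *)
Lemma gaussian_tilt_integral h h' Y Y' (a : R) :
  measurable_fun setT h -> measurable_fun setT h' ->
  measurable_fun setT Y -> measurable_fun setT Y' ->
  (forall w, 0 <= h w) -> (forall w, 0 <= h' w) ->
  (forall u : R, (\int[mu]_w (h w * expR (u * Y w + (4 * a ^+ 2) * Y w ^+ 2))%:E < +oo)%E) ->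
  (forall u : R, (\int[mu]_w (h' w * expR (u * Y' w + (4 * a ^+ 2) * Y' w ^+ 2))%:E < +oo)%E) ->
  (forall u : R, (\int[mu]_w (h w * expR (u * Y w))%:E =
                  \int[mu]_w (h' w * expR (u * Y' w))%:E)%E) ->
  forall u : R, (\int[mu]_w (h w * expR (u * Y w + (- a ^+ 2) * Y w ^+ 2))%:E =
                 \int[mu]_w (h' w * expR (u * Y' w + (- a ^+ 2) * Y' w ^+ 2))%:E)%E.
Proof.
move=> mh mh' mY mY' h0 h'0 F F' E u.
have a40 : 0 <= 4 * a ^+ 2 by rewrite mulr_ge0// sqr_ge0.
pose f (g Z : Omega -> R) (m : nat) := expR_poly g Z (a / m.+1%:R) (m.+1 ^ 2) u.
have EQ m : (\int[mu]_w f h Y m w = \int[mu]_w f h' Y' m w)%E.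
  by have [] := @expR_poly_integral h h' Y Y' (a / m.+1%:R) (m.+1 ^ 2)
    (fun u => weighted_expR_integrable mh mY h0 a40 (F u))
    (fun u => weighted_expR_integrable mh' mY' h'0 a40 (F' u)) E u.
have L (g Z : Omega -> R) : measurable_fun setT g -> measurable_fun setT Z ->
  (forall w, 0 <= g w) ->
  (\int[mu]_w (g w * expR (u * Z w + (4 * a ^+ 2) * Z w ^+ 2))%:E < +oo)%E ->
  (fun m => \int[mu]_w f g Z m w)%E @ \oo -->
  (\int[mu]_w (g w * expR (u * Z w + (- a ^+ 2) * Z w ^+ 2))%:E)%E.
  move=> mg mZ g0 fin.
  have [] := @dominated_convergence _ _ _ mu setT measurableT (f g Z)
    (fun w => (g w * expR (u * Z w + (- a ^+ 2) * Z w ^+ 2))%:E)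
    (fun w => (g w * expR (u * Z w + (4 * a ^+ 2) * Z w ^+ 2))%:E) => //.
  - move=> m; apply/measurable_EFinP; apply: measurable_funM.
      apply: measurable_funM => //.
      by apply: measurableT_comp => //; exact: measurable_funM.
    apply: measurable_funX; apply: measurable_funB.
      apply: measurable_funM => //.
      by apply: measurableT_comp => //; exact: measurable_funM.
    apply: measurableT_comp => //.
    by apply: measurable_funM => //; exact: measurable_funM.
  - by apply/measurable_EFinP; exact: measurable_weighted_expR.
  - apply: aeW => w _; apply: cvg_EFin.
      by apply: nearW.
    rewrite expRD mulrA.
    rewrite (_ : fine \o _ = (fun m : nat => g w * expR (u * Z w) *
      (2 * expR ((a * Z w) / m.+1%:R) - expR (2 * ((a * Z w) / m.+1%:R))) ^+ (m.+1 ^ 2))); last first.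
      by apply/funext => m; rewrite /f /expR_poly /= (mulrAC a (Z w)).
    have -> : - a ^+ 2 * Z w ^+ 2 = - (a * Z w) ^+ 2 by rewrite exprMn mulNr.
    by apply: cvgM; [exact: cvg_cst|exact: cvg_expR_sqr].
  - apply/integrableP; split.
      by apply/measurable_EFinP; exact: measurable_weighted_expR.
    under eq_integral do rewrite gee0_abs ?lee_fin ?mulr_ge0 ?expR_ge0//.
    exact: fin.
  - apply: aeW => w m _; rewrite /f /expR_poly lee_fin normrM ger0_norm ?mulr_ge0 ?expR_ge0//.
    rewrite [X in _ <= _ * X]expRD [leRHS]mulrA ler_wpM2l ?mulr_ge0 ?expR_ge0//.
    set t := a / m.+1%:R * Z w.
    have -> : 4 * a ^+ 2 * Z w ^+ 2 = (m.+1 ^ 2)%:R * (4 * t ^+ 2).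
      by rewrite natrX /t; field.
    rewrite (expRM_natl (m.+1 ^ 2)) normrX lerXn2r// ?nnegrE ?expR_ge0//.
    have -> : 2 * expR t - expR (2 * t) = 1 - (expR t - 1) ^+ 2.
      by rewrite expRM_natl; ring.
    apply: le_trans (sqr_expR_sub1_le t).
    by rewrite (le_trans (ler_normB _ _))// normr1 lerD2l ger0_norm// sqr_ge0.
apply: cvg_unique (L h Y mh mY h0 (F u)) _ => //.
rewrite (funext EQ); exact: L.
Qed.

End exponential_moments_determine.

(** * Smoothed indicators of intervals *)

Section gaussian_windows.
Context {R : realType}.
Local Notation mu := (@lebesgue_measure R).

(* A smoothed indicator of |y| <= s: the probability that |y + tau N| <= s for
   a standard normal N. *)
Definition window (s tau y : R) : R := fine (normal_prob y tau `[- s, s]).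

Lemma windowE s tau y :
  (window s tau y)%:E =
  (\int[mu]_x (normal_pdf y tau x * \1_(`[- s, s] : set R) x)%:E)%E.
Proof.
rewrite /window fineK; last first.
  rewrite ge0_fin_numE//; apply: (@le_lt_trans _ _ 1%E); last by rewrite ltry.
  exact: probability_le1.
rewrite /normal_prob integral_mkcond; apply: eq_integral => x _.
by rewrite patchE indicE; case: (x \in _); rewrite ?mulr1 ?mulr0.
Qed.

Lemma window_ge0 s tau y : 0 <= window s tau y.
Proof. exact/fine_ge0. Qed.

Lemma window_le1 s tau y : window s tau y <= 1.
Proof.
rewrite -lee_fin /window fineK; first exact: probability_le1.
rewrite ge0_fin_numE//; apply: (@le_lt_trans _ _ 1%E); last by rewrite ltry.
exact: probability_le1.
Qed.

Lemma measurable_normal_pdf2 tau : tau != 0 ->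
  measurable_fun setT
    (fun p : measurableTypeR R * measurableTypeR R => normal_pdf p.1 tau p.2).
Proof.
move=> t0; under eq_fun do rewrite normal_pdfE// /normal_fun.
apply: measurable_funM => //; apply: measurableT_comp => //.
apply: measurable_funM => //; apply: measurableT_comp => //.
apply: measurable_funX; apply: measurable_funB; exact: measurable_snd || exact: measurable_fst.
Qed.

Lemma measurable_window_integrand s tau : tau != 0 ->
  measurable_fun setT
    (fun p : measurableTypeR R * measurableTypeR R =>
      normal_pdf p.1 tau p.2 * \1_(`[- s, s] : set R) p.2).
Proof.
move=> t0; apply: measurable_funM; first exact: measurable_normal_pdf2.
have mI : measurable_fun setT (\1_(`[- s, s] : set R) : R -> R) by exact: measurable_indic.
exact: (measurableT_comp mI measurable_snd).
Qed.

Lemma measurable_window s tau : tau != 0 ->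
  measurable_fun setT (window s tau).
Proof.
move=> t0.
have mf : measurable_fun setT (fun p : measurableTypeR R * measurableTypeR R =>
      (normal_pdf p.1 tau p.2 * \1_(`[- s, s] : set R) p.2)%:E).
  by apply/measurable_EFinP; exact: measurable_window_integrand.
have := @measurable_fun_fubini_tonelli_F _ _ _ _ R mu
  (fun p : measurableTypeR R * measurableTypeR R =>
      (normal_pdf p.1 tau p.2 * \1_(`[- s, s] : set R) p.2)%:E) mf.
move=> H; apply/measurable_EFinP.
rewrite (_ : EFin \o window s tau = fubini_F mu (fun p : measurableTypeR R * measurableTypeR R =>
      (normal_pdf p.1 tau p.2 * \1_(`[- s, s] : set R) p.2)%:E)).
  by apply: H => x; rewrite lee_fin mulr_ge0 ?normal_pdf_ge0.
by apply/funext => y; rewrite /= windowE.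
Qed.

(** Chebyshev for the smoothing variable: with [window_upper], a window agrees with the indicator up
    to 6 tau^2 / D^2 outside a collar of width [D] around the endpoints. *)
Lemma window_lower s tau y D : 0 < tau -> 0 < D -> `|y| <= s - D ->
  1 - 6 * tau ^+ 2 / D ^+ 2 <= window s tau y.
Proof.
move=> t0 D0; rewrite ler_norml => /andP[ya yb].
pose I : set R := [set` `[- s, s]].
have mI : measurable I by exact: measurable_itv.
have : (normal_prob y tau (~` I) <= (6 * tau ^+ 2 / D ^+ 2)%:E)%E.
  apply: normal_prob_tail_le => //; first exact: measurableC.
  move=> x /= /negP; rewrite in_itv/= negb_and -!ltNge => /orP[h|h].
    by rewrite ler0_norm; lra.
  by rewrite ger0_norm; lra.
have := probability_setC (normal_prob y tau) mI.
have fin : normal_prob y tau I \is a fin_num.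
  rewrite ge0_fin_numE//; apply: (@le_lt_trans _ _ 1%E); last by rewrite ltry.
  exact: probability_le1.
move=> -> H; have := lee_fin (1 - fine (normal_prob y tau I)) (6 * tau ^+ 2 / D ^+ 2).
by rewrite EFinB fineK// H /window -/I => /esym; lra.
Qed.

Lemma window_upper s tau y D : 0 < tau -> 0 < D -> s + D <= `|y| ->
  window s tau y <= 6 * tau ^+ 2 / D ^+ 2.
Proof.
move=> t0 D0 yD.
have fin : normal_prob y tau `[- s, s] \is a fin_num.
  rewrite ge0_fin_numE//; apply: (@le_lt_trans _ _ 1%E); last by rewrite ltry.
  exact: probability_le1.
rewrite -lee_fin /window fineK//; apply: normal_prob_tail_le => //.
move=> x /=; rewrite in_itv/= => /andP[xa xb].
have : `|x| <= s by rewrite ler_norml xa.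
have := ler_distD x y 0; rewrite !subr0 (distrC y x); lra.
Qed.

End gaussian_windows.

(** * Expectations of products of windows are determined by exponential moments *)

Section window_expectations.
Context {R : realType} {d : measure_display} {Omega : measurableType d}.
Context (P : probability Omega R).
Implicit Types (Y h : Omega -> R).

(* One application of gaussian_tilt_integral consumes a quarter of the available
   square-exponential integrability but creates its own: the weight c can be raised
   to 5 c / 4, and iterating makes it arbitrarily large. *)
Lemma gaussian_weight_integral h h' Y Y' (k : R) :
  measurable_fun setT h -> measurable_fun setT h' ->
  measurable_fun setT Y -> measurable_fun setT Y' ->
  (forall w, 0 <= h w) -> (forall w, 0 <= h' w) -> 0 < k ->
  (forall u : R, (\int[P]_w (h w * expR (u * Y w + k * Y w ^+ 2))%:E < +oo)%E) ->
  (forall u : R, (\int[P]_w (h' w * expR (u * Y' w + k * Y' w ^+ 2))%:E < +oo)%E) ->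
  (forall u : R, (\int[P]_w (h w * expR (u * Y w))%:E =
                  \int[P]_w (h' w * expR (u * Y' w))%:E)%E) ->
  forall n (u : R),
  (\int[P]_w (h w * expR (u * Y w + (- (k / 4 * (5 / 4) ^+ n)) * Y w ^+ 2))%:E =
   \int[P]_w (h' w * expR (u * Y' w + (- (k / 4 * (5 / 4) ^+ n)) * Y' w ^+ 2))%:E)%E.
Proof.
move=> mh mh' mY mY' h0 h'0 k0 F F' E; elim=> [|n IH] u.
  rewrite expr0 mulr1.
  have a2 : Num.sqrt (k / 4) ^+ 2 = k / 4 by rewrite sqr_sqrtr// divr_ge0// ltW.
  have k4 : 4 * Num.sqrt (k / 4) ^+ 2 = k by rewrite a2; field.
  have := @gaussian_tilt_integral _ _ _ P h h' Y Y' (Num.sqrt (k / 4)) mh mh' mY mY' h0 h'0.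
  by rewrite k4 a2; apply.
set c := k / 4 * (5 / 4) ^+ n in IH *.
have c0 : 0 < c by rewrite mulr_gt0 ?exprn_gt0//; lra.
have a2 : Num.sqrt (c / 4) ^+ 2 = c / 4 by rewrite sqr_sqrtr// divr_ge0// ltW.
have k4 : 4 * Num.sqrt (c / 4) ^+ 2 = c by rewrite a2; field.
have -> : k / 4 * (5 / 4) ^+ n.+1 = c + c / 4 by rewrite exprSr /c; field.
pose g (f Z : Omega -> R) w := f w * expR (- c * Z w ^+ 2).
have mg (f Z : Omega -> R) : measurable_fun setT f -> measurable_fun setT Z ->
    measurable_fun setT (g f Z).
  move=> mf mZ; apply: measurable_funM => //; apply: measurableT_comp => //.
  by apply: measurable_funM => //; exact: measurable_funX.
have g0 (f Z : Omega -> R) : (forall w, 0 <= f w) -> forall w, 0 <= g f Z w.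
  by move=> f0 w; rewrite mulr_ge0 ?expR_ge0.
have G (f Z : Omega -> R) v e w :
    g f Z w * expR (v * Z w + e * Z w ^+ 2) = f w * expR (v * Z w + (e - c) * Z w ^+ 2).
  by rewrite /g -mulrA -expRD; congr (_ * expR _); ring.
have G0 (f Z : Omega -> R) v w :
    g f Z w * expR (v * Z w) = f w * expR (v * Z w + (- c) * Z w ^+ 2).
  by rewrite /g -mulrA -expRD; congr (_ * expR _); ring.
have FF (f Z : Omega -> R) : measurable_fun setT f -> measurable_fun setT Z ->
  (forall w, 0 <= f w) ->
  (forall u : R, (\int[P]_w (f w * expR (u * Z w + k * Z w ^+ 2))%:E < +oo)%E) ->
  forall v : R, (\int[P]_w (g f Z w * expR (v * Z w + c * Z w ^+ 2))%:E < +oo)%E.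
  move=> mf mZ f0 Ff v; apply: le_lt_trans (Ff v); apply: ge0_le_integral => //.
  - by move=> w _; rewrite lee_fin mulr_ge0 ?expR_ge0// g0.
  - by apply/measurable_EFinP; apply: measurable_weighted_expR => //; exact: mg.
  - by apply/measurable_EFinP; exact: measurable_weighted_expR.
  - move=> w _; rewrite lee_fin G subrr ler_wpM2l// ler_expR lerD2l.
    by rewrite mul0r mulr_ge0 ?sqr_ge0// ltW.
have := @gaussian_tilt_integral _ _ _ P (g h Y) (g h' Y') Y Y' (Num.sqrt (c / 4))
  (mg _ _ mh mY) (mg _ _ mh' mY') mY mY' (g0 _ _ h0) (g0 _ _ h'0).
rewrite k4 a2 => /(_ (FF _ _ mh mY h0 F) (FF _ _ mh' mY' h'0 F')) H.
have -> : - (c + c / 4) = - (c / 4) - c by ring.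
under eq_integral do rewrite -G.
under [RHS]eq_integral do rewrite -G.
apply: H => v.
under eq_integral do rewrite G0.
under [RHS]eq_integral do rewrite G0.
exact: IH.
Qed.

(** Expanding (x - Y)^2 exhibits the window as a mixture over x in [- s, s] of exp((x / tau^2) Y -
    Y^2 / (2 tau^2)), with coefficients common to both sides; by Fubini only tilted exponential
    moments remain to be compared. *)
Lemma window_integral_eq h h' Y Y' (s tau : R) :
  measurable_fun setT h -> measurable_fun setT h' ->
  measurable_fun setT Y -> measurable_fun setT Y' ->
  (forall w, 0 <= h w) -> (forall w, 0 <= h' w) -> 0 < tau ->
  (forall u : R,
  (\int[P]_w (h w * expR (u * Y w + (- (tau ^+ 2 *+ 2)^-1) * Y w ^+ 2))%:E =
   \int[P]_w (h' w * expR (u * Y' w + (- (tau ^+ 2 *+ 2)^-1) * Y' w ^+ 2))%:E)%E) ->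
  (\int[P]_w (h w * window s tau (Y w))%:E =
   \int[P]_w (h' w * window s tau (Y' w))%:E)%E.
Proof.
move=> mh mh' mY mY' h0 h'0 t0 E.
have T (f Z : Omega -> R) : measurable_fun setT f -> measurable_fun setT Z ->
  (forall w, 0 <= f w) ->
  (\int[P]_w (f w * window s tau (Z w))%:E =
   \int[lebesgue_measure]_x ((normal_peak tau * expR (- x ^+ 2 / (tau ^+ 2 *+ 2)) *
      \1_(`[- s, s] : set R) x)%:E *
   \int[P]_w (f w * expR (x / tau ^+ 2 * Z w +
      (- (tau ^+ 2 *+ 2)^-1) * Z w ^+ 2))%:E))%E.
  move=> mf mZ f0.
  pose F (p : Omega * measurableTypeR R) : \bar R :=
    (f p.1 * (normal_pdf (Z p.1) tau p.2 * \1_(`[- s, s] : set R) p.2))%:E.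
  have F0 p : (0 <= F p)%E.
    by rewrite lee_fin !mulr_ge0// ?normal_pdf_ge0.
  have mF : measurable_fun setT F.
    apply/measurable_EFinP; apply: measurable_funM.
      exact: (measurableT_comp mf measurable_fst).
    apply: (measurableT_comp (f := (fun p : measurableTypeR R * measurableTypeR R =>
      normal_pdf p.1 tau p.2 * \1_(`[- s, s] : set R) p.2))
      (g := fun p : Omega * measurableTypeR R => (Z p.1, p.2))).
      by apply: measurable_window_integrand; rewrite gt_eqF.
    apply: measurable_fun_pair => /=; last exact: measurable_snd.
    exact: (measurableT_comp mZ measurable_fst).
  have := @fubini_tonelli _ _ _ _ R P lebesgue_measure F mF F0.
  rewrite (eq_integral (fun w => (f w * window s tau (Z w))%:E)); last first.
    move=> w _; rewrite /F/= EFinM windowE.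
    rewrite -ge0_integralZl_EFin//.
    - by move=> x _; rewrite lee_fin mulr_ge0 ?normal_pdf_ge0.
    - apply/measurable_EFinP; apply: measurable_funM => //.
      exact: measurable_normal_pdf.
  move=> ->; apply: eq_integral => x _.
  rewrite -ge0_integralZl_EFin//.
  - apply: eq_integral => w _; rewrite /F/= -EFinM; congr EFin.
    rewrite normal_pdfE ?gt_eqF// /normal_fun.
    rewrite (_ : - (x - Z w) ^+ 2 / (tau ^+ 2 *+ 2) =
       - x ^+ 2 / (tau ^+ 2 *+ 2) + (x / tau ^+ 2 * Z w +
         (- (tau ^+ 2 *+ 2)^-1) * Z w ^+ 2)); last first.
      by field; exact: lt0r_neq0.
    by rewrite [in LHS]expRD; ring.
  - by move=> w _; rewrite lee_fin mulr_ge0 ?expR_ge0.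
  - by apply/measurable_EFinP; exact: measurable_weighted_expR.
  - by rewrite !mulr_ge0// ?expR_ge0 ?normal_peak_ge0.
rewrite (T h Y mh mY h0) (T h' Y' mh' mY' h'0).
by apply: eq_integral => x _; rewrite E.
Qed.

End window_expectations.

Section window_products.
Context {R : realType} {d : measure_display} {Omega : measurableType d}.
Context (P : probability Omega R).

Lemma measurable_lin_comb m (u : nat -> R) (Y : nat -> Omega -> R) :
  (forall i, measurable_fun setT (Y i)) ->
  measurable_fun setT (fun w => \sum_(i < m) u i * Y i w).
Proof. by move=> mY; apply: measurable_sum => i; exact: measurable_funM. Qed.

Lemma measurable_window_prod m (s tau : R) (Y : nat -> Omega -> R) : 0 < tau ->
  (forall i, measurable_fun setT (Y i)) ->
  measurable_fun setT (fun w => \prod_(i < m) window s tau (Y i w)).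
Proof.
move=> t0 mY; apply: measurable_prod => i _.
by apply: measurableT_comp => //; apply: measurable_window; rewrite gt_eqF.
Qed.

(** The windows are treated one at a time, the last one being absorbed into the weight: hence [h]
    and [h'] are arbitrary and introduced after the variables. The equation on [tau] puts 1 / (2
    tau^2) on the geometric grid reached by [gaussian_weight_integral]; [tau] can still tend to 0
    along it. *)
Lemma window_prod_integral_eq m (k tau s : R) n (Y Y' : nat -> Omega -> R) :
  0 < k -> 0 < tau -> (tau ^+ 2 *+ 2)^-1 = k / 4 * (5 / 4) ^+ n ->
  (forall i, measurable_fun setT (Y i)) -> (forall i, measurable_fun setT (Y' i)) ->
  forall h h' : Omega -> R,
  measurable_fun setT h -> measurable_fun setT h' ->
  (forall w, 0 <= h w) -> (forall w, 0 <= h' w) ->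
  (forall (u : nat -> R) j, (j < m)%N ->
    (\int[P]_w (h w * expR (\sum_(i < m) u i * Y i w + k * Y j w ^+ 2))%:E < +oo)%E) ->
  (forall (u : nat -> R) j, (j < m)%N ->
    (\int[P]_w (h' w * expR (\sum_(i < m) u i * Y' i w + k * Y' j w ^+ 2))%:E < +oo)%E) ->
  (forall u : nat -> R,
    (\int[P]_w (h w * expR (\sum_(i < m) u i * Y i w))%:E =
     \int[P]_w (h' w * expR (\sum_(i < m) u i * Y' i w))%:E)%E) ->
  (\int[P]_w (h w * \prod_(i < m) window s tau (Y i w))%:E =
   \int[P]_w (h' w * \prod_(i < m) window s tau (Y' i w))%:E)%E.
Proof.
move=> k0 t0 tk mY mY'; elim: m => [|m IH] h h' mh mh' h0 h'0 F F' E.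
  have := E (fun=> 0).
  under eq_integral do rewrite big_ord0 expR0.
  under [X in _ = X -> _]eq_integral do rewrite big_ord0 expR0.
  move=> {}E.
  under eq_integral do rewrite big_ord0.
  by under [RHS]eq_integral do rewrite big_ord0.
have upd (u : nat -> R) (v : R) (Z : nat -> Omega -> R) w :
  \sum_(i < m.+1) (if i == m :> nat then v else u i) * Z i w =
  \sum_(i < m) u i * Z i w + v * Z m w.
  rewrite big_ord_recr /= eqxx; congr (_ + _); apply: eq_bigr => i _.
  by rewrite ltn_eqF.
have mW (Z : nat -> Omega -> R) j : (forall i, measurable_fun setT (Z i)) ->
  measurable_fun setT (fun w => window s tau (Z j w)).
  move=> mZ; apply: (measurableT_comp (f := window s tau)) => //.
  by apply: measurable_window; rewrite gt_eqF.
have mE (g : Omega -> R) (Z : nat -> Omega -> R) (u : nat -> R) : measurable_fun setT g ->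
  (forall i, measurable_fun setT (Z i)) ->
  measurable_fun setT (fun w => g w * expR (\sum_(i < m) u i * Z i w)).
  move=> mg mZ; apply: measurable_funM => //; apply: measurableT_comp => //.
  exact: measurable_lin_comb.
(* The exponentials of the first [m] variables are frozen into the weight, which leaves a
   one-variable identity in [Y m]. *)
have step (u : nat -> R) :
  (\int[P]_w (h w * window s tau (Y m w) * expR (\sum_(i < m) u i * Y i w))%:E =
   \int[P]_w (h' w * window s tau (Y' m w) * expR (\sum_(i < m) u i * Y' i w))%:E)%E.
  under eq_integral do rewrite mulrAC.
  under [RHS]eq_integral do rewrite mulrAC.
  apply: (@window_integral_eq _ _ _ P
    (fun w => h w * expR (\sum_(i < m) u i * Y i w))
    (fun w => h' w * expR (\sum_(i < m) u i * Y' i w)) (Y m) (Y' m) s tau).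
  - exact: mE.
  - exact: mE.
  - exact: mY.
  - exact: mY'.
  - by move=> w; rewrite mulr_ge0 ?expR_ge0.
  - by move=> w; rewrite mulr_ge0 ?expR_ge0.
  - exact: t0.
  rewrite tk.
  apply: (@gaussian_weight_integral _ _ _ P
    (fun w => h w * expR (\sum_(i < m) u i * Y i w))
    (fun w => h' w * expR (\sum_(i < m) u i * Y' i w)) (Y m) (Y' m) k).
  - exact: mE.
  - exact: mE.
  - exact: mY.
  - exact: mY'.
  - by move=> w; rewrite mulr_ge0 ?expR_ge0.
  - by move=> w; rewrite mulr_ge0 ?expR_ge0.
  - exact: k0.
  - move=> v; have := F (fun i => if i == m then v else u i) m (ltnSn m).
    by under eq_integral do rewrite upd -addrA expRD mulrA.
  - move=> v; have := F' (fun i => if i == m then v else u i) m (ltnSn m).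
    by under eq_integral do rewrite upd -addrA expRD mulrA.
  - move=> v; have := E (fun i => if i == m then v else u i).
    under eq_integral do rewrite upd expRD mulrA.
    by under [X in _ = X -> _]eq_integral do rewrite upd expRD mulrA.
have fin (g : Omega -> R) (Z : nat -> Omega -> R) : measurable_fun setT g ->
  (forall i, measurable_fun setT (Z i)) -> (forall w, 0 <= g w) ->
  (forall (u : nat -> R) j, (j < m.+1)%N ->
    (\int[P]_w (g w * expR (\sum_(i < m.+1) u i * Z i w + k * Z j w ^+ 2))%:E < +oo)%E) ->
  (forall (u : nat -> R) j, (j < m)%N ->
    (\int[P]_w (g w * window s tau (Z m w) *
       expR (\sum_(i < m) u i * Z i w + k * Z j w ^+ 2))%:E < +oo)%E).
  move=> mg mZ g0 Fg u j jm.
  apply: le_lt_trans (Fg (fun i => if i == m then 0 else u i) j (ltnW jm)).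
  apply: ge0_le_integral => //.
  - by move=> w _; rewrite lee_fin !mulr_ge0 ?expR_ge0 ?window_ge0.
  - apply/measurable_EFinP; apply: measurable_funM.
      by apply: measurable_funM => //; exact: mW.
    apply: measurableT_comp => //; apply: measurable_funD; first exact: measurable_lin_comb.
    by apply: measurable_funM => //; exact: measurable_funX.
  - apply/measurable_EFinP; apply: measurable_funM => //.
    apply: measurableT_comp => //; apply: measurable_funD; first exact: (measurable_lin_comb m.+1 (fun i => if i == m then 0 else u i)).
    by apply: measurable_funM => //; exact: measurable_funX.
  - move=> w _; rewrite lee_fin upd mul0r addr0 ler_wpM2r ?expR_ge0//.
    by rewrite ler_piMr// window_le1.
under eq_integral do rewrite big_ord_recr /= [X in _ * X]mulrC mulrA.
under [RHS]eq_integral do rewrite big_ord_recr /= [X in _ * X]mulrC mulrA.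
apply: (IH (fun w => h w * window s tau (Y m w)) (fun w => h' w * window s tau (Y' m w))) => //.
- by apply: measurable_funM => //; exact: mW.
- by apply: measurable_funM => //; exact: mW.
- by move=> w; rewrite mulr_ge0 ?window_ge0.
- by move=> w; rewrite mulr_ge0 ?window_ge0.
- exact: fin.
- exact: fin.
Qed.

End window_products.

(** * The L2 geometry of a linear space of centered Gaussian variables *)

Section gaussian_spaces.
Context {R : realType} {d : measure_display} {Omega : measurableType d}.
Context (P : probability Omega R).
Implicit Types (Y Z : Omega -> R).

(** Only one-dimensional laws are recorded; closure under linear combinations then yields all joint
    exponential moments, in the spirit of the Cramer-Wold device. *)
Definition gaussian_space (S : (Omega -> R) -> Prop) : Prop :=
  [/\ S (fun=> 0),
      forall (a : R) Y Z, S Y -> S Z -> S (fun w => a * Y w + Z w),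
      forall Y, S Y -> measurable_fun setT Y &
      forall Y, S Y -> centered_gaussian_real P Y].

Definition covar Y Z : R := fine (\int[P]_w (Y w * Z w)%:E)%E.
Local Notation var := (variance2 P).

Context (S : (Omega -> R) -> Prop) (GS : gaussian_space S).

Let SM Y : S Y -> measurable_fun setT Y. Proof. by case: GS => _ _ + _; apply. Qed.
Let Slin (a : R) Y Z : S Y -> S Z -> S (fun w => a * Y w + Z w).
Proof. by case: GS => _ + _ _; apply. Qed.
Let S0 : S (fun=> 0). Proof. by case: GS. Qed.
Let SG Y : S Y -> centered_gaussian_real P Y. Proof. by case: GS => _ _ _; apply. Qed.

Lemma gaussian_spaceZ (a : R) Y : S Y -> S (fun w => a * Y w).
Proof.
move=> SY; have := Slin a SY S0.
by congr S; apply/funext => w; rewrite addr0.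
Qed.

Lemma gaussian_spaceB Y Z : S Y -> S Z -> S (fun w => Y w - Z w).
Proof.
move=> SY SZ; have := Slin (-1) SZ SY.
by congr S; apply/funext => w; rewrite mulN1r addrC.
Qed.

Lemma gaussian_space_sum m (u : nat -> R) (Y : nat -> Omega -> R) :
  (forall i, S (Y i)) -> S (fun w => \sum_(i < m) u i * Y i w).
Proof.
move=> SY; elim: m => [|m IH].
  by have := S0; congr S; apply/funext => w; rewrite big_ord0.
have := Slin (u m) (SY m) IH.
by congr S; apply/funext => w; rewrite big_ord_recr /= addrC.
Qed.

Lemma var_integral Y : S Y -> (\int[P]_w (Y w ^+ 2)%:E = (var Y)%:E)%E.
Proof. by move=> SY; have [] := centered_gaussian_real_moments (SM SY) (SG SY). Qed.

Lemma var_ge0 Y : 0 <= var Y.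
Proof. by apply/fine_ge0/integral_ge0 => w _; rewrite lee_fin sqr_ge0. Qed.

Lemma expR_integral Y : S Y -> (\int[P]_w (expR (Y w))%:E = (expR (var Y / 2))%:E)%E.
Proof.
move=> SY; have [_ /(_ 1) E _] := centered_gaussian_real_moments (SM SY) (SG SY).
by move: E; rewrite expr1n mul1r => <-; apply: eq_integral => w _; rewrite mul1r.
Qed.

Lemma expR_sqr_integral_lty Y (k : R) : S Y -> 4 * k * var Y <= 1 ->
  (\int[P]_w (expR (k * Y w ^+ 2))%:E < +oo)%E.
Proof. by move=> SY; have [_ _] := centered_gaussian_real_moments (SM SY) (SG SY); apply. Qed.

Lemma mul_integrable Y Z : S Y -> S Z -> P.-integrable setT (fun w => (Y w * Z w)%:E).
Proof.
move=> SY SZ; apply/integrableP; split.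
  by apply/measurable_EFinP; apply: measurable_funM; exact: SM.
apply: (@le_lt_trans _ _ (\int[P]_w ((Y w ^+ 2)%:E + (Z w ^+ 2)%:E))%E).
  apply: ge0_le_integral => //.
  - apply/measurableT_comp => //; apply/measurable_EFinP.
    by apply: measurable_funM; exact: SM.
  - by apply: emeasurable_funD; apply/measurable_EFinP; apply: measurable_funX; exact: SM.
  - move=> w _; rewrite -EFinD /= lee_fin ler_norml; apply/andP; split; nra.
rewrite ge0_integralD//.
- by rewrite !var_integral// -EFinD ltry.
- by move=> w _; rewrite lee_fin sqr_ge0.
- by apply/measurable_EFinP; apply: measurable_funX; exact: SM.
- by move=> w _; rewrite lee_fin sqr_ge0.
- by apply/measurable_EFinP; apply: measurable_funX; exact: SM.
Qed.

Lemma covarC Y Z : covar Y Z = covar Z Y.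
Proof. by rewrite /covar; congr fine; apply: eq_integral => w _; rewrite mulrC. Qed.

Lemma covar_var Y : covar Y Y = var Y.
Proof. by rewrite /covar /variance2; congr fine; apply: eq_integral. Qed.

Lemma covarDl (a : R) Y Z W : S Y -> S Z -> S W ->
  covar (fun w => a * Y w + Z w) W = a * covar Y W + covar Z W.
Proof.
move=> SY SZ SW; rewrite /covar.
have iY := mul_integrable SY SW; have iZ := mul_integrable SZ SW.
have fY := integrable_fin_num measurableT iY; have fZ := integrable_fin_num measurableT iZ.
transitivity (fine (\int[P]_w (a%:E * (Y w * W w)%:E + (Z w * W w)%:E))%E).
  congr fine; apply: eq_integral => w _; rewrite -EFinM -EFinD; congr EFin; ring.
rewrite integralD//; last exact: integrableZl.
rewrite integralZl// fineD//; last by rewrite fin_numM.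
by rewrite fineM.
Qed.

Lemma var_lin (a : R) Y Z : S Y -> S Z ->
  var (fun w => a * Y w + Z w) = a ^+ 2 * var Y + 2 * a * covar Y Z + var Z.
Proof.
move=> SY SZ; rewrite -!covar_var covarDl//; last exact: Slin.
rewrite !(covarC _ (fun w => a * Y w + Z w)) !covarDl// (covarC Z Y); ring.
Qed.

Lemma covarZl (a : R) Y Z : S Y -> S Z -> covar (fun w => a * Y w) Z = a * covar Y Z.
Proof.
move=> SY SZ; have := covarDl a SY S0 SZ.
rewrite (_ : covar (fun=> 0) Z = 0) ?addr0; last first.
  rewrite /covar (_ : (fun w => (0 * Z w)%:E) = cst 0%E); first by rewrite integral0.
  by apply/funext => w; rewrite mul0r.
by move=> <-; congr covar; apply/funext => w; rewrite addr0.
Qed.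

Lemma varZ (a : R) Y : S Y -> var (fun w => a * Y w) = a ^+ 2 * var Y.
Proof.
move=> SY; have SaY := gaussian_spaceZ a SY.
by rewrite -!covar_var covarZl// covarC covarZl// mulrA expr2.
Qed.

Lemma covarBl Y Z W : S Y -> S Z -> S W ->
  covar (fun w => Y w - Z w) W = covar Y W - covar Z W.
Proof.
move=> SY SZ SW; have := covarDl (-1) SZ SY SW; rewrite mulN1r addrC => <-.
by congr covar; apply/funext => w; rewrite mulN1r addrC.
Qed.

Lemma varB Y Z : S Y -> S Z ->
  var (fun w => Y w - Z w) = var Y - 2 * covar Y Z + var Z.
Proof.
move=> SY SZ; have := var_lin (-1) SZ SY; rewrite (covarC Z Y).
rewrite (_ : (fun w => -1 * Z w + Y w) = (fun w => Y w - Z w)); last first.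
  by apply/funext => w; rewrite mulN1r addrC.
by move=> ->; ring.
Qed.

Lemma varBC Y Z : S Y -> S Z -> var (fun w => Y w - Z w) = var (fun w => Z w - Y w).
Proof. by move=> SY SZ; rewrite !varB// (covarC Z Y); ring. Qed.

Lemma var_quasi_triangle Y Z W : S Y -> S Z -> S W ->
  var (fun w => Y w - W w) <=
  2 * var (fun w => Y w - Z w) + 2 * var (fun w => Z w - W w).
Proof.
move=> SY SZ SW.
have SA := gaussian_spaceB SY SZ; have SB := gaussian_spaceB SZ SW.
have -> : (fun w => Y w - W w) = (fun w => 1 * (Y w - Z w) + (Z w - W w)).
  by apply/funext => w; ring.
rewrite var_lin//.
have := var_ge0 (fun w => (Y w - Z w) - (Z w - W w)).
by rewrite varB//; lra.
Qed.

Lemma covar_suml m (u : nat -> R) (Y : nat -> Omega -> R) Z :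
  (forall i, S (Y i)) -> S Z ->
  covar (fun w => \sum_(i < m) u i * Y i w) Z = \sum_(i < m) u i * covar (Y i) Z.
Proof.
move=> SY SZ; elim: m => [|m IH].
  rewrite big_ord0 /covar (_ : (fun w => _) = cst 0%E); first by rewrite integral0.
  by apply/funext => w; rewrite big_ord0 mul0r.
rewrite big_ord_recr /= -IH addrC -covarDl//; last exact: gaussian_space_sum.
by congr covar; apply/funext => w; rewrite big_ord_recr /= addrC.
Qed.

(** The constant 16 is the 4 of the square-exponential moment, doubled by (Y - c)^2 <= 2 Y^2 + 2 c^2
    and doubled again by a b <= a^2 + b^2, which separates [L] from [Y]. *)
Lemma expR_mixed_integral_lty L Y (k c0 c : R) : S L -> S Y -> 0 <= k ->
  16 * k * var Y <= 1 ->
  (\int[P]_w (expR (c0 + L w + k * (Y w - c) ^+ 2))%:E < +oo)%E.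
Proof.
move=> SL SY k0 kv.
pose A := expR (c0 + 2 * k * c ^+ 2).
have mY := SM SY; have mL := SM SL.
have m1 : measurable_fun setT (fun w => expR (2 * L w)).
  by apply: measurableT_comp => //; exact: measurable_funM.
have m2 : measurable_fun setT (fun w => expR (4 * k * Y w ^+ 2)).
  by apply: measurableT_comp => //; apply: measurable_funM => //; exact: measurable_funX.
apply: (@le_lt_trans _ _ (\int[P]_w (A%:E * ((expR (2 * L w))%:E + (expR (4 * k * Y w ^+ 2))%:E)))%E).
  apply: ge0_le_integral => //.
  - apply/measurable_EFinP; apply: measurableT_comp => //; apply: measurable_funD.
      by apply: measurable_funD.
    by apply: measurable_funM => //; apply: measurable_funX; exact: measurable_funB.
  - by apply: measurable_funeM; apply: emeasurable_funD; exact/measurable_EFinP.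
  - move=> w _; rewrite -EFinD -EFinM lee_fin.
    have -> : c0 + L w + k * (Y w - c) ^+ 2 = (c0 + 2 * k * c ^+ 2) +
      (L w + 2 * k * Y w ^+ 2 - k * (Y w + c) ^+ 2) by ring.
    rewrite expRD ler_wpM2l ?expR_ge0//.
    apply: (@le_trans _ _ (expR (L w) * expR (2 * k * Y w ^+ 2))).
      by rewrite -expRD ler_expR lerBlDr lerDl mulr_ge0// sqr_ge0.
    have -> : 2 * L w = L w + L w by ring.
    have -> : 4 * k * Y w ^+ 2 = 2 * k * Y w ^+ 2 + 2 * k * Y w ^+ 2 by ring.
    by rewrite !expRD; nra.
rewrite ge0_integralZl//.
- rewrite ge0_integralD//; last 2 first.
  + exact/measurable_EFinP.
  + exact/measurable_EFinP.
  rewrite (expR_integral (gaussian_spaceZ 2 SL)).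
  have := @expR_sqr_integral_lty Y (4 * k) SY.
  have -> : 4 * (4 * k) * var Y = 16 * k * var Y by ring.
  move=> /(_ kv) h; apply: lte_mul_pinfty; rewrite ?lee_fin ?expR_ge0//.
  by rewrite lte_add_pinfty// ltry.
- by apply: emeasurable_funD; exact/measurable_EFinP.
- by move=> w _; rewrite -EFinD lee_fin addr_ge0 ?expR_ge0.
- by rewrite lee_fin expR_ge0.
Qed.

End gaussian_spaces.

Section measurable_boxes.
Context {R : realType} {d : measure_display} {Omega : measurableType d}.

Lemma measurable_forall_lt m (Y : nat -> Omega -> R) (c : nat -> R) (a : R) :
  (forall i, measurable_fun setT (Y i)) ->
  measurable [set w | forall i, (i < m)%N -> `|Y i w - c i| < a].
Proof.
move=> mY.
rewrite (_ : [set w | _] = \bigcap_(i in `I_m) [set w | `|Y i w - c i| < a]); last first.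
  by apply/seteqP; split=> w /= h i; exact: h.
apply: fin_bigcap_measurable => // i _; rewrite -[X in measurable X]setTI.
rewrite (_ : [set w | _] = (fun w => `|Y i w - c i|) @^-1` `]-oo, a[).
  have mi : measurable_fun setT (fun w => `|Y i w - c i|).
    by apply: measurableT_comp => //; exact: measurable_funB.
  by apply: mi => //; exact: measurable_itv.
by apply/seteqP; split => w /=; rewrite in_itv.
Qed.

Lemma measurable_forall_le m (Y : nat -> Omega -> R) (a : R) :
  (forall i, measurable_fun setT (Y i)) ->
  measurable [set w | forall i, (i < m)%N -> `|Y i w| <= a].
Proof.
move=> mY.
rewrite (_ : [set w | _] = \bigcap_(i in `I_m) [set w | `|Y i w| <= a]); last first.
  by apply/seteqP; split=> w /= h i; exact: h.
apply: fin_bigcap_measurable => // i _; rewrite -[X in measurable X]setTI.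
rewrite (_ : [set w | _] = (fun w => `|Y i w|) @^-1` `]-oo, a]).
  have mi : measurable_fun setT (fun w => `|Y i w|) by exact: measurableT_comp.
  by apply: mi => //; exact: measurable_itv.
by apply/seteqP; split => w /=; rewrite in_itv.
Qed.

End measurable_boxes.

(** * A one-sided Cameron-Martin inequality and packing numbers *)

Section packing.
Context {R : realType} {d : measure_display} {Omega : measurableType d}.
Context (P : probability Omega R).
Context (S : (Omega -> R) -> Prop) (GS : gaussian_space P S).
Local Notation var := (variance2 P).
Local Notation covar := (covar P).

Let SM Y : S Y -> measurable_fun setT Y. Proof. by case: GS => _ _ + _; apply. Qed.
Let Slin (a : R) Y Z : S Y -> S Z -> S (fun w => a * Y w + Z w).
Proof. by case: GS => _ + _ _; apply. Qed.
Let S0 : S (fun=> 0). Proof. by case: GS. Qed.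

Lemma expR_affine_integral (c0 : R) (Z : Omega -> R) : S Z ->
  (\int[P]_w (expR (c0 + Z w))%:E = (expR (c0 + var Z / 2))%:E)%E.
Proof.
move=> SZ; under eq_integral do rewrite expRD EFinM.
rewrite ge0_integralZl//.
- by rewrite (expR_integral GS SZ) -EFinM -expRD.
- by apply/measurable_EFinP; apply: measurableT_comp => //; exact: SM.
Qed.

(** Weighting by exp(- z - var(z) / 2) moves each [Y i] by [- covar z (Y i)]. For a linear
    combination L of the [Y i] both sides have exponential moment exp(var(L) / 2 - covar(z, L)), and
    this determines the window products. *)
Lemma cameron_martin_window m (k tau s : R) n z (Y : nat -> Omega -> R) :
  S z -> (forall i, S (Y i)) -> 0 < k -> 0 < tau ->
  (tau ^+ 2 *+ 2)^-1 = k / 4 * (5 / 4) ^+ n ->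
  (forall i, (i < m)%N -> 16 * k * var (Y i) <= 1) ->
  (\int[P]_w (expR (- z w - var z / 2) * \prod_(i < m) window s tau (Y i w))%:E =
   \int[P]_w (\prod_(i < m) window s tau (Y i w - covar z (Y i)))%:E)%E.
Proof.
move=> Sz SY k0 t0 tk kv.
have mz := SM Sz; have mY i := SM (SY i).
under [RHS]eq_integral do rewrite -[X in X%:E]mul1r.
apply: (@window_prod_integral_eq _ _ _ P m k tau s n Y
  (fun i w => Y i w - covar z (Y i)) k0 t0 tk mY _
  (fun w => expR (- z w - var z / 2)) (fun=> 1)).
- by move=> i; apply: measurable_funB.
- apply: measurableT_comp => //; apply: measurable_funB => //.
  exact: measurable_funN.
- exact: measurable_cst.
- by move=> w; exact: expR_ge0.
- by move=> w; exact: ler01.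
- move=> u j jm.
  rewrite (eq_integral (fun w => (expR (- (var z / 2) +
      (\sum_(i < m) u i * Y i w - z w) + k * (Y j w - 0) ^+ 2))%:E)); last first.
    by move=> w _; rewrite -expRD; congr (expR _)%:E; ring.
  apply: (expR_mixed_integral_lty GS) => //; last exact: kv.
  + by apply: (gaussian_spaceB GS) => //; exact: (gaussian_space_sum GS).
  + exact: ltW.
- move=> u j jm.
  rewrite (eq_integral (fun w => (expR (- (\sum_(i < m) u i * covar z (Y i)) +
       (\sum_(i < m) u i * Y i w) + k * (Y j w - covar z (Y j)) ^+ 2))%:E)); last first.
    move=> w _; rewrite mul1r.
    have -> : \sum_(i < m) u i * (Y i w - covar z (Y i)) =
      - (\sum_(i < m) u i * covar z (Y i)) + \sum_(i < m) u i * Y i w; last by [].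
    by rewrite addrC -sumrB; apply: eq_bigr => i _; rewrite mulrBr.
  apply: (expR_mixed_integral_lty GS) => //; last exact: kv.
  + exact: (gaussian_space_sum GS).
  + exact: ltW.
- move=> u; set L := fun w => \sum_(i < m) u i * Y i w.
  have SL : S L by exact: (gaussian_space_sum GS).
  have cL : \sum_(i < m) u i * covar z (Y i) = covar z L.
    rewrite (covarC P z) (covar_suml GS)//; apply: eq_bigr => i _; by rewrite covarC.
  transitivity (\int[P]_w (expR (- (var z / 2) + (L w - z w)))%:E)%E.
    by apply: eq_integral => w _; rewrite -expRD; congr (expR _)%:E; rewrite /L; ring.
  transitivity (\int[P]_w (expR (- covar z L + L w))%:E)%E; last first.
    apply: eq_integral => w _; rewrite mul1r; congr (expR _)%:E.
    by rewrite -cL addrC -sumrB; apply: eq_bigr => i _; rewrite mulrBr.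
  rewrite !expR_affine_integral//; last exact: (gaussian_spaceB GS).
  by rewrite (varB GS)// (covarC P L); congr (expR _)%:E; field.
Qed.

Lemma geometric_small (c e : R) : 0 < c -> 0 < e -> exists n, c / (5 / 4) ^+ n <= e.
Proof.
move=> c0 e0.
have h n : 1 + n%:R / 4 <= (5 / 4 : R) ^+ n.
  have := @bernoulli_le R (5 / 4) n ltac:(lra); move: ((5 / 4) ^+ n) => g; lra.
have [n hn] : exists n : nat, 4 * (c / e) <= n%:R.
  by exists (Num.truncn (4 * (c / e))).+1; apply/ltW; rewrite truncnS_gt.
have g0 : 0 < (5 / 4 : R) ^+ n by apply: exprn_gt0; lra.
exists n; rewrite ler_pdivrMr//.
rewrite -ler_pdivrMl// mulrC; apply: le_trans (h n); lra.
Qed.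

(** The windows are sandwiched between boxes of half-widths [s - D] and [s + D], and [tau] is sent
    to 0 with [m] fixed. The density stays under the integral, to be bounded below where [z] itself
    is small. *)
Lemma cameron_martin_le m (s D : R) z (Y : nat -> Omega -> R) :
  S z -> (forall i, S (Y i)) -> 0 < D ->
  (\int[P]_(w in [set w | forall i, (i < m)%N -> (`|Y i w| <= s - D)%R])
     (expR (- z w - var z / 2))%:E <=
   P [set w | forall i, (i < m)%N -> (`|Y i w - covar z (Y i)| < s + D)%R])%E.
Proof.
move=> Sz SY D0.
have mz := SM Sz; have mY i := SM (SY i).
set A := [set w | _]; set B := [set w | _].
have mA : measurable A by exact: measurable_forall_le.
have mB : measurable B by exact: (measurable_forall_lt _ (fun i => covar z (Y i))).
pose K := 1 + \sum_(i < m) var (Y i).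
(* The constant [K] dominates all the variances at once, so that [k] = 1 / (16 K) is admissible for
   every [Y i]. *)
have K1 : 1 <= K by rewrite lerDl sumr_ge0// => i _; exact: var_ge0.
pose k := 1 / (16 * K).
have k0 : 0 < k by rewrite divr_gt0// mulr_gt0//; lra.
have kv i : (i < m)%N -> 16 * k * var (Y i) <= 1.
  move=> im; rewrite /k.
  have -> : 16 * (1 / (16 * K)) * var (Y i) = var (Y i) / K by field; rewrite gt_eqF//; lra.
  rewrite ler_pdivrMr ?mul1r; last lra.
  rewrite /K (bigD1 (Ordinal im))//=.
  have : 0 <= \sum_(i0 < m | i0 != Ordinal im) var (Y i0).
    by rewrite sumr_ge0// => j _; exact: var_ge0.
  by lra.
have mh : measurable_fun setT (fun w => expR (- z w - var z / 2)).
  apply: measurableT_comp => //; apply: measurable_funB => //; exact: measurable_funN.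
set I := (\int[P]_(w in A) _)%E.
have I0 : (0 <= I)%E by apply: integral_ge0 => w _; rewrite lee_fin expR_ge0.
have I1 : (I <= 1)%E.
  apply: (@le_trans _ _ (\int[P]_w (expR (- z w - var z / 2))%:E)%E).
    by apply: ge0_subset_integral => //; exact/measurable_EFinP.
  rewrite (eq_integral (fun w => (expR (- (var z / 2) + -1 * z w))%:E)); last first.
    by move=> w _; rewrite mulN1r addrC.
  have := expR_affine_integral (- (var z / 2)) (gaussian_spaceZ GS (-1) Sz).
  by rewrite (varZ GS)// sqrrN expr1n mul1r addNr expR0 => ->.
have If : I \is a fin_num by rewrite ge0_fin_numE// (le_lt_trans I1)// ltry.
have Pf : P B \is a fin_num by exact: fin_num_measure.
rewrite -(fineK If) -(fineK Pf) lee_fin; set a := fine I; set b := fine (P B).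
have a0 : 0 <= a by exact: fine_ge0.
have a1 : a <= 1 by rewrite -lee_fin fineK.
(* Each of the [m] windows on the left costs [eta], and so does the bound outside [B] on the right;
   as a <= 1, it is enough that (m + 1) eta <= e. The index [n] achieves this, and [tau] is then
   read off the grid equation. *)
apply/ler_addgt0Pl => e e0.
pose q := e / m.+1%:R.
have q0 : 0 < q by rewrite divr_gt0.
have [n nq] := @geometric_small (12 / (k * D ^+ 2)) q ltac:(by rewrite divr_gt0// mulr_gt0// exprn_gt0) q0.
pose tau := Num.sqrt (2 / (k * (5 / 4) ^+ n)).
have g0 : 0 < (5 / 4 : R) ^+ n by apply: exprn_gt0; lra.
have tau2 : tau ^+ 2 = 2 / (k * (5 / 4) ^+ n) by rewrite sqr_sqrtr// divr_ge0// mulr_ge0 ?ltW.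
have t0 : 0 < tau by rewrite sqrtr_gt0 divr_gt0// mulr_gt0.
have tk : (tau ^+ 2 *+ 2)^-1 = k / 4 * (5 / 4) ^+ n.
  rewrite tau2 -(mulr_natr _ 2); move: ((5 / 4) ^+ n) g0 => g g0; field.
  by rewrite !gt_eqF.
have etaq : 6 * tau ^+ 2 / D ^+ 2 <= q.
  apply: le_trans nq; rewrite tau2 le_eqVlt; apply/orP; left; apply/eqP.
  by move: ((5 / 4) ^+ n) g0 => g g0; field; rewrite !gt_eqF.
set eta := 6 * tau ^+ 2 / D ^+ 2 in etaq.
have eta0 : 0 <= eta by apply: divr_ge0; [apply: mulr_ge0|]; rewrite ?sqr_ge0.
have E := @cameron_martin_window m k tau s n z Y Sz SY k0 t0 tk kv.
have lo : ((a * (1 - m%:R * eta))%:E <=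
   \int[P]_w (expR (- z w - var z / 2) * \prod_(i < m) window s tau (Y i w))%:E)%E.
  have [neg|pos] := ltP (1 - m%:R * eta) 0.
    apply: (@le_trans _ _ 0%E); first by rewrite lee_fin mulr_ge0_le0// ltW.
    apply: integral_ge0 => w _; rewrite lee_fin mulr_ge0 ?expR_ge0//.
    by apply: prodr_ge0 => i _; exact: window_ge0.
  apply: (@le_trans _ _ (\int[P]_(w in A) ((1 - m%:R * eta)%:E * (expR (- z w - var z / 2))%:E))%E).
    rewrite ge0_integralZl//; last first.
      by apply/measurable_EFinP; exact: measurable_funTS.
    by rewrite -/I -(fineK If) -/a -EFinM mulrC.
  apply: (@le_trans _ _ (\int[P]_(w in A) (expR (- z w - var z / 2) * \prod_(i < m) window s tau (Y i w))%:E)%E); last first.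
    apply: ge0_subset_integral => //.
    - by apply/measurable_EFinP; apply: measurable_funM => //; exact: measurable_window_prod.
    - move=> w _; rewrite lee_fin mulr_ge0 ?expR_ge0//.
      by apply: prodr_ge0 => i _; exact: window_ge0.
  apply: ge0_le_integral => //.
  - by move=> w _; rewrite -EFinM lee_fin mulr_ge0 ?expR_ge0.
  - by apply: measurable_funeM; apply/measurable_EFinP; exact: measurable_funTS.
  - by apply/measurable_EFinP; apply: measurable_funTS; apply: measurable_funM => //; exact: measurable_window_prod.
  - move=> w Aw; rewrite -EFinM lee_fin mulrC ler_wpM2l ?expR_ge0//.
    have H : forall j, (j <= m)%N -> 1 - j%:R * eta <= \prod_(i < j) window s tau (Y i w).
      elim=> [|j IH] jm; first by rewrite big_ord0 mul0r subr0.
      rewrite big_ord_recr /= -[j.+1]addn1 natrD.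
      have p1 : \prod_(i < j) window s tau (Y i w) <= 1.
        by apply: prodr_ile1 => i _; rewrite window_ge0 window_le1.
      have p0 : 0 <= \prod_(i < j) window s tau (Y i w).
        by apply: prodr_ge0 => i _; exact: window_ge0.
      have := IH (ltnW jm).
      have := @window_lower _ s tau (Y j w) D t0 D0 (Aw j jm); rewrite -/eta.
      by have := window_le1 s tau (Y j w); nra.
    exact: H.
have up : (\int[P]_w (\prod_(i < m) window s tau (Y i w - covar z (Y i)))%:E <= (b + eta)%:E)%E.
  rewrite EFinD /b fineK//.
  apply: (@le_trans _ _ (\int[P]_w ((\1_B w)%:E + eta%:E))%E); last first.
    rewrite ge0_integralD//; last first.
      by apply/measurable_EFinP; exact: measurable_indic.
    by rewrite integral_indic// setIT integral_cst//= probability_setT mule1.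
  apply: ge0_le_integral => //.
  - by move=> w _; rewrite lee_fin; apply: prodr_ge0 => i _; exact: window_ge0.
  - apply/measurable_EFinP; apply: (@measurable_window_prod _ _ _ m s tau (fun i w => Y i w - covar z (Y i))) => // i.
    exact: measurable_funB.
  - by apply: emeasurable_funD => //; apply/measurable_EFinP; exact: measurable_indic.
  - move=> w _; rewrite -EFinD lee_fin.
    have [Bw|nBw] := pselect (B w).
      rewrite indicE mem_set//=; apply: (@le_trans _ _ 1); last by rewrite lerDl.
      by apply: prodr_ile1 => i _; rewrite window_ge0 window_le1.
    rewrite indicE memNset//= add0r.
    have [j jm jw] : exists2 j, (j < m)%N & s + D <= `|Y j w - covar z (Y j)|.
      apply: contrapT => h; apply: nBw => j jm; rewrite ltNge; apply/negP => hj.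
      by apply: h; exists j.
    rewrite (bigD1 (Ordinal jm))//=.
    have := @window_upper _ s tau _ D t0 D0 jw; rewrite -/eta.
    have q1 : \prod_(i < m | i != Ordinal jm) window s tau (Y i w - covar z (Y i)) <= 1.
      by apply: prodr_ile1 => i _; rewrite window_ge0 window_le1.
    have := window_ge0 s tau (Y j w - covar z (Y j)).
    by move=> w0 we; rewrite (le_trans _ we)// ler_piMr.
have : ((a * (1 - m%:R * eta))%:E <= (b + eta)%:E)%E.
  by apply: le_trans lo _; rewrite E.
rewrite lee_fin => H.
have : m.+1%:R * eta <= e by rewrite mulrC -ler_pdivlMr.
rewrite -[m.+1]addn1 natrD; have : 0 <= m%:R * eta by rewrite mulr_ge0.
nra.
Qed.

End packing.

Section packing_bound.
Context {R : realType} {d : measure_display} {Omega : measurableType d}.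
Context (P : probability Omega R).
Context (S : (Omega -> R) -> Prop) (GS : gaussian_space P S).
Local Notation var := (variance2 P).
Local Notation covar := (covar P).

Let SM Y : S Y -> measurable_fun setT Y. Proof. by case: GS => _ _ + _; apply. Qed.

(** The shift by [t * z i] moves coordinate j by t cov(z_i, z_j). A point common to the boxes [B i]
    and [B j] satisfies four bounds, on coordinates i and j, which add up to t var(z_i - z_j) < 4
    (3/2) e = 6 e, against the assumption on [t]. *)
Lemma packing_bound N (z : nat -> Omega -> R) (p e t rho2 R2 : R) :
  (forall i, S (z i)) -> 0 < e -> 0 < t -> 6 * e <= t * rho2 -> 0 <= p ->
  (forall i, (i < N)%N -> var (z i) <= R2) ->
  (forall i j, (i < N)%N -> (j < N)%N -> i != j ->
     rho2 <= var (fun w => z i w - z j w)) ->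
  (p%:E <= P [set w | forall i, (i < N)%N -> (`|z i w| <= e)%R])%E ->
  N%:R * (p * expR (- (t ^+ 2 * R2 / 2 + t * e))) <= 1.
Proof.
move=> Sz e0 t0 te p0 zR zrho.
set A := [set w | _] => pA.
have mA : measurable A by apply: measurable_forall_le => i; exact: SM.
pose y i := fun w => t * z i w.
have Sy i : S (y i) by exact: (gaussian_spaceZ GS).
have cy i j : covar (y i) (z j) = t * covar (z i) (z j) by exact: (covarZl GS).
(* Half-width 5e/4 and collar e/4: the inner box is the small ball of radius [e], the outer one has
   half-width 3e/2. *)
pose B i := [set w | forall j, (j < N)%N -> `|z j w - covar (y i) (z j)| < 5 / 4 * e + 1 / 4 * e].
have mB i : measurable (B i).
  by apply: (measurable_forall_lt _ (fun j => covar (y i) (z j))) => j; exact: SM.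
set q := p * _.
have PB i : (i < N)%N -> (q%:E <= P (B i))%E.
  move=> iN.
  have D0 : 0 < 1 / 4 * e by lra.
  apply: le_trans (@cameron_martin_le _ _ _ P S GS N (5 / 4 * e) (1 / 4 * e) (y i) z (Sy i) Sz D0).
  have -> : 5 / 4 * e - 1 / 4 * e = e by lra.
  rewrite -/A.
  apply: (@le_trans _ _ (\int[P]_(w in A) (expR (- (t ^+ 2 * R2 / 2 + t * e)))%:E)%E).
    rewrite integral_cst// /q mulrC EFinM; exact: lee_wpmul2l.
  apply: ge0_le_integral => //.
  - apply/measurable_EFinP; apply: measurable_funTS; apply: measurableT_comp => //.
    apply: measurable_funB => //; apply: measurable_funN; exact: SM.
  - move=> w Aw; rewrite lee_fin ler_expR (varZ GS)//.
    have := Aw i iN; rewrite ler_norml => /andP[za zb].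
    have h1 : t * z i w <= t * e by rewrite ler_pM2l.
    have h2 : t ^+ 2 * var (z i) <= t ^+ 2 * R2 by rewrite ler_pM2l ?exprn_gt0// zR.
    by rewrite /y; lra.
have sumB w : \sum_(i < N) \1_(B i) w <= 1 :> R.
  have [[i Bi]|nB] := pselect (exists i : 'I_N, B i w); last first.
    rewrite big1// => i _; rewrite indicE memNset// => Bi.
    by apply: nB; exists i.
  rewrite (bigD1 i)//= big1 ?addr0; first by rewrite indicE; case: (_ \in _).
  move=> j ji; rewrite indicE memNset// => Bj.
  have ij : (i : nat) != j by rewrite eq_sym.
  have := zrho i j (ltn_ord i) (ltn_ord j) ij.
  rewrite (varB GS)// => hrho.
  have := Bi i (ltn_ord i); have := Bi j (ltn_ord j).
  have := Bj i (ltn_ord i); have := Bj j (ltn_ord j).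
  rewrite !cy !(covar_var P) (covarC P (z j)) !ltr_norml.
  move=> /andP[? ?] /andP[? ?] /andP[? ?] /andP[? ?].
  have : t * rho2 <= t * (var (z i) - 2 * covar (z i) (z j) + var (z j)).
    by rewrite ler_pM2l.
  lra.
have -> : N%:R * q = \sum_(i < N) q by rewrite sumr_const card_ord mulr_natl.
rewrite -lee_fin -sumEFin.
apply: (@le_trans _ _ (\sum_(i < N) \int[P]_w (\1_(B i) w)%:E)%E).
  by apply: lee_sum => i _; rewrite integral_indic// setIT; exact: PB.
rewrite -ge0_integral_sum//; last first.
  by move=> i; apply/measurable_EFinP; exact: measurable_indic.
apply: (@le_trans _ _ (\int[P]_w (cst 1%E w))%E); last first.
  by rewrite integral_cst//= probability_setT mule1.
apply: ge0_le_integral => //.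
- by move=> w _; rewrite sumEFin lee_fin sumr_ge0.
- by apply: emeasurable_sum => i; apply/measurable_EFinP; exact: measurable_indic.
- by move=> w _; rewrite sumEFin lee_fin.
Qed.

End packing_bound.

(** * Nets for the squared L2 distance *)

Section nets.
Context {R : realType} {d : measure_display} {Omega : measurableType d}.
Context (P : probability Omega R).
Context (S : (Omega -> R) -> Prop) (GS : gaussian_space P S).
Local Notation var := (variance2 P).

Context (M : nat) (xi : 'I_M -> Omega -> R) (Sxi : forall i, S (xi i)).

Definition dist2 i j : R := var (fun w => xi i w - xi j w).

Let SM Y : S Y -> measurable_fun setT Y. Proof. by case: GS => _ _ + _; apply. Qed.

Lemma dist2xx i : dist2 i i = 0.
Proof.
rewrite /dist2 /variance2 (_ : (fun w => _) = cst 0%E); first by rewrite integral0.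
by apply/funext => w; rewrite subrr expr0n.
Qed.

Lemma dist2C i j : dist2 i j = dist2 j i.
Proof. exact: (varBC GS). Qed.

Lemma measurable_small_ball (e : R) :
  measurable [set w | forall i : 'I_M, `|xi i w| <= e].
Proof.
rewrite (_ : [set w | _] = \bigcap_(i in setT) [set w | `|xi i w| <= e]); last first.
  by apply/seteqP; split=> w /= h i; [move=> _|]; exact: h.
apply: fin_bigcap_measurable; first exact: finite_finset.
move=> i _; rewrite -[X in measurable X]setTI.
rewrite (_ : [set w | _] = (fun w => `|xi i w|) @^-1` `]-oo, e]).
  have mi : measurable_fun setT (fun w => `|xi i w|).
    by apply: measurableT_comp => //; exact: SM.
  by apply: mi => //; exact: measurable_itv.
by apply/seteqP; split => w /=; rewrite in_itv.
Qed.

(** A maximal separated subset of the ball around [c] is automatically a net of that ball, and its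
    cardinality is bounded by [packing_bound] applied to the differences with [xi c]. *)
Lemma local_net (c : 'I_M) (r2 e phi : R) : 0 < r2 -> 0 < e ->
  ((expR (- phi))%:E <= P [set w | forall i : 'I_M, (`|xi i w| <= e)%R])%E ->
  exists J : {set 'I_M},
    (forall g, dist2 g c <= 4 * r2 -> exists2 j, j \in J & dist2 g j <= r2) /\
    #|J|%:R <= expR (phi + 364 * e ^+ 2 / r2).
Proof.
move=> r20 e0 sb.
pose p (J : {set 'I_M}) := [forall i in J, dist2 i c <= 4 * r2] &&
  [forall i in J, forall j in J, (i != j) ==> (r2 <= dist2 i j)].
have p0 : p (finset.set0 : {set 'I_M}).
  by apply/andP; split; apply/forall_inP => i; rewrite inE.
have [J /maxsetP[pJ maxJ] _] := maxset_exists p0.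
have [/forall_inP Jc /forall_inP Jsep] := andP pJ.
exists J; split.
  move=> g gc; have [gJ|gJ] := boolP (g \in J).
    by exists g => //; rewrite dist2xx ltW.
  apply: contrapT => nc.
  have far j : j \in J -> r2 <= dist2 g j.
    by move=> jJ; rewrite leNgt; apply/negP => /ltW h; apply: nc; exists j.
  have pg : p (g |: J)%SET.
    apply/andP; split.
      by apply/forall_inP => i; rewrite !inE => /orP[/eqP ->//|]; exact: Jc.
    apply/forall_inP => i; rewrite !inE => /orP[/eqP ->|iJ].
      apply/forall_inP => j; rewrite !inE => /orP[/eqP ->|jJ]; first by rewrite eqxx.
      by apply/implyP => _; exact: far.
    apply/forall_inP => j; rewrite !inE => /orP[/eqP ->|jJ].
      by apply/implyP => _; rewrite dist2C; exact: far.
    by have /forall_inP := Jsep _ iJ; apply.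
  have := maxJ _ pg (finset.subsetUr _ _) => eJ.
  by move: gJ; rewrite -eJ !inE eqxx.
pose z (i : nat) w := xi (nth c (enum J) i) w - xi c w.
have Sz i : S (z i) by exact: (gaussian_spaceB GS).
have inJ i : (i < #|J|)%N -> nth c (enum J) i \in J.
  by move=> iN; rewrite -mem_enum mem_nth// -cardE.
(* Differences with [xi c] are bounded by 2 e on the small ball, so t r2 >= 12 e is required. The
   choice 13 gives the exponent (2 * 13^2 + 2 * 13) e^2 / r2 = 364 e^2 / r2. *)
pose t := 13 * e / r2.
have t0 : 0 < t by rewrite divr_gt0// mulr_gt0.
have h1 : 6 * (2 * e) <= t * r2 by rewrite /t divfK ?gt_eqF//; lra.
have := @packing_bound _ _ _ P S GS #|J| z (expR (- phi)) (2 * e) t r2 (4 * r2) Sz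
  ltac:(lra) t0 h1 (expR_ge0 _).
have -> : t ^+ 2 * (4 * r2) / 2 + t * (2 * e) = 364 * e ^+ 2 / r2.
  by rewrite /t; field; rewrite gt_eqF.
rewrite -expRD -opprD; set q := phi + _ => H.
rewrite -[leRHS]mul1r -ler_pdivrMr ?expR_gt0// -expRN; apply: H.
- by move=> i iN; exact: Jc (inJ i iN).
- move=> i j iN jN ij.
  have -> : (fun w => z i w - z j w) =
     (fun w => xi (nth c (enum J) i) w - xi (nth c (enum J) j) w).
    by apply/funext => w; rewrite /z; ring.
  have /forall_inP /(_ _ (inJ j jN)) /implyP := Jsep _ (inJ i iN); apply.
  by rewrite nth_uniq ?enum_uniq// -cardE.
- apply: le_trans sb _; apply: le_measure; rewrite ?inE.
  + exact: measurable_small_ball.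
  + by apply: measurable_forall_le => i; exact: SM.
  + move=> w h i iN; rewrite /z (le_trans (ler_normB _ _))//.
    by have := h (nth c (enum J) i); have := h c; lra.
Qed.

(** Local nets are composed, starting from a single point since [r0] bounds all squared distances: a
    cell of level n is a ball of squared radius 4 r2 with r2 = r0 / 4^(n+1), as in [local_net], and
    the cardinalities multiply. *)
Lemma nets_exist (r0 : R) (phi eps : nat -> R) : (0 < M)%N -> 0 < r0 ->
  (forall i j, dist2 i j <= r0) -> (forall n, 0 < eps n) ->
  (forall n, ((expR (- phi n))%:E <=
     P [set w | forall i : 'I_M, (`|xi i w| <= eps n)%R])%E) ->
  forall n, exists T : {set 'I_M},
    (forall g, exists2 j, j \in T & dist2 g j <= r0 / 4 ^+ n) /\
    #|T|%:R <= expR (\sum_(i < n) (phi i.+1 + 364 * eps i.+1 ^+ 2 / (r0 / 4 ^+ i.+1))).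
Proof.
move=> M0 r00 diam eps0 sb; elim=> [|n [T [Tnet Tcard]]].
  exists [set Ordinal M0]%SET; split; last by rewrite cards1 big_ord0 expR0.
  by move=> g; exists (Ordinal M0); rewrite ?inE// expr0 divr1.
set r2 := r0 / 4 ^+ n.+1.
have g0 : 0 < 4 ^+ n :> R by rewrite exprn_gt0.
have r20 : 0 < r2 by rewrite divr_gt0// exprn_gt0.
have r4 : 4 * r2 = r0 / 4 ^+ n by rewrite /r2 exprS; field; rewrite gt_eqF.
have [F HF] := choice (fun c => local_net c r20 (eps0 n.+1) (sb n.+1)).
exists (\bigcup_(c in T) F c)%SET; split.
  move=> g; have [c cT gc] := Tnet g.
  have [+ _] := HF c => /(_ g); rewrite r4 => /(_ gc)[j jF gj].
  by exists j => //; apply/bigcupP; exists c.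
rewrite big_ord_recr /= expRD.
have le1 : (#|\bigcup_(c in T) F c|%SET <= \sum_(c in T) #|F c|)%N.
  elim/big_rec2: _ => [|c a B _ IH]; first by rewrite cards0.
  by rewrite (leq_trans (leq_card_setU _ _))// leq_add2l.
apply: (@le_trans _ _ (\sum_(c in T) #|F c|)%:R); first by rewrite ler_nat.
rewrite natr_sum.
apply: (@le_trans _ _ (\sum_(c in T) expR (phi n.+1 + 364 * eps n.+1 ^+ 2 / r2))).
  by apply: ler_sum => c _; have [_] := HF c.
by move: (expR (phi n.+1 + _)) (expR_ge0 (phi n.+1 + 364 * eps n.+1 ^+ 2 / r2)) => q q0;
  rewrite sumr_const -[leLHS]mulr_natl ler_wpM2r.
Qed.

End nets.

(** * Chaining for exponential moments *)

Section chaining.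
Context {R : realType} {d : measure_display} {Omega : measurableType d}.
Context (P : probability Omega R).
Context (S : (Omega -> R) -> Prop) (GS : gaussian_space P S).
Local Notation var := (variance2 P).
Local Notation covar := (covar P).

Let SM Y : S Y -> measurable_fun setT Y. Proof. by case: GS => _ _ + _; apply. Qed.

(* Weighted AM-GM, the missing weight being put on the number 1. *)
Lemma expR_jensen K (w A : 'I_K -> R) : (forall k, 0 <= w k) -> \sum_k w k <= 1 ->
  expR (\sum_k w k * A k) <= 1 - \sum_k w k + \sum_k w k * expR (A k).
Proof.
move=> w0 w1; set W := \sum_k w k in w1 *; set m := (X in _ <= X).
have m0 : 0 < m.
  rewrite /m; have [W1|W1] := ltP W 1.
    rewrite ltr_pwDl ?subr_gt0// sumr_ge0// => k _.
    by rewrite mulr_ge0// expR_ge0.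
  have {w1}W1 : W = 1 by apply/eqP; rewrite eq_le w1.
  rewrite W1 subrr add0r lt_neqAle eq_sym sumr_ge0 ?andbT; last first.
    by move=> k _; rewrite mulr_ge0// expR_ge0.
  apply/negP => /eqP/psumr_eq0P h.
  have : W = 0.
    rewrite /W big1// => k _; have := h _ k isT.
    move=> /(_ (fun k _ => mulr_ge0 (w0 k) (expR_ge0 _)))/eqP.
    by rewrite mulf_eq0 expR_eq0 orbF => /eqP.
  by rewrite W1 => /eqP; rewrite oner_eq0.
rewrite -[leRHS](lnK (m0 : m \is Num.pos)) ler_expR.
(* This is the tangent line of the logarithm at [m], the right-hand side of the claim; the missing
   weight 1 - W is absorbed by 1 - 1/m <= ln m. *)
have h k : w k * A k <= w k * (ln m + (expR (A k) / m - 1)).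
  apply: ler_wpM2l => //; rewrite -lerBlDl.
  have := expR_ge1Dx (A k - ln m).
  by rewrite expRB (lnK (m0 : m \is Num.pos)); lra.
apply: (le_trans (ler_sum _ (fun k _ => h k))).
have -> : \sum_k w k * (ln m + (expR (A k) / m - 1)) =
   W * ln m + (\sum_k w k * expR (A k)) / m - W.
  rewrite /W !mulr_suml -big_split /= -sumrB; apply: eq_bigr => k _; ring.
have -> : \sum_k w k * expR (A k) = m - (1 - W) by rewrite /m; ring.
have lm : 1 - m^-1 <= ln m.
  have := expR_ge1Dx (- ln m); rewrite expRN (lnK (m0 : m \is Num.pos)); lra.
have -> : (m - (1 - W)) / m = 1 - (1 - W) / m by field; rewrite gt_eqF.
have : 0 <= (1 - W) * (ln m - (1 - m^-1)) by rewrite mulr_ge0 ?subr_ge0.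
lra.
Qed.

(** Under the measure tilted by a X, the recentred variable Y - a covar(X, Y) keeps the exponential
    moments of Y, whatever the correlation of X and Y. *)
Lemma tilt_integral (X Y : Omega -> R) (a b c0 : R) : S X -> S Y ->
  (\int[P]_w (expR (a * X w - a ^+ 2 * var X / 2 + b * (Y w - a * covar X Y) - c0))%:E =
  (expR (b ^+ 2 * var Y / 2 - c0))%:E)%E.
Proof.
move=> SX SY.
rewrite (eq_integral (fun w => (expR ((- (a ^+ 2 * var X / 2) - b * a * covar X Y - c0) +
   (a * X w + b * Y w)))%:E)); last first.
  by move=> w _; congr (expR _)%:E; ring.
have SbY := gaussian_spaceZ GS b SY.
have SZ : S (fun w => a * X w + b * Y w) by case: GS => _ + _ _; apply.
rewrite (expR_affine_integral GS _ SZ) (var_lin GS)// (varZ GS)//.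
rewrite (covarC P X (fun w => b * Y w)) (covarZl GS)// (covarC P Y).
by congr (expR _)%:E; field.
Qed.

Context (M : nat) (xi : 'I_M -> Omega -> R) (Sxi : forall i, S (xi i)).
Local Notation dist2 := (dist2 P xi).

Lemma measurable_exceed (a : R) : measurable [set w | exists i : 'I_M, a < xi i w].
Proof.
rewrite (_ : [set w | _] = \bigcup_(i in setT) [set w | a < xi i w]); last first.
  by apply/seteqP; split=> w /= [i]; [move=> h; exists i|exists i].
apply: fin_bigcup_measurable; first exact: finite_finset.
move=> i _; rewrite -[X in measurable X]setTI.
rewrite (_ : [set w | _] = xi i @^-1` `]a, +oo[).
  by apply: SM => //; exact: measurable_itv.
by apply/seteqP; split => w /=; rewrite in_itv /= andbT.
Qed.

(** The link of level k is given the weight [wt k], so that [expR_jensen] turns the exponential of a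
    chain into a weighted sum of exponentials of single links, each divided by its weight. The union
    bound thus takes place inside an expectation: the coarsest net is counted once, through [L 0],
    and each set of links only in proportion to its weight. *)
Lemma chaining (K : nat) (N : nat -> {set 'I_M}) (r sigma2 theta : R)
    (L wt : nat -> R) (lambda : R) :
  0 < r -> 0 < theta -> (forall k, 0 < wt k) -> \sum_(k < K) wt k <= 1 ->
  (forall i, var (xi i) <= sigma2) ->
  (forall k g, exists2 j, j \in N k & dist2 g j <= r / 4 ^+ k) ->
  N K = [set: 'I_M]%SET ->
  (forall k, (k <= K)%N -> #|N k|%:R <= expR (L k)) ->
  (P [set w | exists i : 'I_M, (lambda < xi i w)%R] <=
   (expR (- theta * lambda + theta ^+ 2 * sigma2 / 2 + L 0%N +
      \sum_(k < K) wt k * (L k + L k.+1 + 2 * theta ^+ 2 * (r / 4 ^+ k) / wt k ^+ 2)))%:E)%E.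
Proof.
move=> r0 th0 wt0 wt1 vs net NK card.
(* The term [b k] pays for the number of links, at most exp(L k + L (k + 1)), and for the log-moment
   of theta / wt_k times a link, whose variance is at most 4 r / 4^k. *)
pose b k := L k + L k.+1 + 2 * theta ^+ 2 * (r / 4 ^+ k) / wt k ^+ 2.
have [pi0 Hpi0] : exists pi0 : nat -> 'I_M -> 'I_M, forall k g,
    pi0 k g \in N k /\ dist2 g (pi0 k g) <= r / 4 ^+ k.
  have h k : exists f : 'I_M -> 'I_M, forall g, f g \in N k /\ dist2 g (f g) <= r / 4 ^+ k.
    have h' g : exists j, j \in N k /\ dist2 g j <= r / 4 ^+ k.
      by have [j jN gj] := net k g; exists j.
    by have [f Hf] := choice h'; exists f.
  by have [f Hf] := choice h; exists f.
(* A chosen nearest point in the last net could differ from [g], even though this net is everything;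
   the identity at level [K] makes the telescoping sum end at [g]. *)
pose pi k g := if k == K then g else pi0 k g.
have piN k g : pi k g \in N k.
  by rewrite /pi; case: eqP => [->|_]; [rewrite NK inE|have [] := Hpi0 k g].
have pid k g : dist2 g (pi k g) <= r / 4 ^+ k.
  rewrite /pi; case: eqP => [->|_]; last by have [] := Hpi0 k g.
  by rewrite dist2xx divr_ge0 ?exprn_ge0// ltW.
pose E k := [pred p : 'I_M * 'I_M | [&& p.1 \in N k, p.2 \in N k.+1 &
   dist2 p.1 p.2 <= 4 * (r / 4 ^+ k)]].
have piE k g : (pi k g, pi k.+1 g) \in E k.
  rewrite inE /= !piN /=.
  have := @var_quasi_triangle _ _ _ P S GS (xi (pi k g)) (xi g) (xi (pi k.+1 g))
    (Sxi _) (Sxi _) (Sxi _).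
  have := pid k g; have := pid k.+1 g.
  rewrite -/(dist2 (pi k g) (pi k.+1 g)) -/(dist2 g (pi k.+1 g)) -/(dist2 (pi k g) g).
  rewrite (dist2C GS Sxi (pi k g) g).
  have -> : r / 4 ^+ k.+1 = (r / 4 ^+ k) / 4.
    by rewrite exprS; field; rewrite gt_eqF// exprn_gt0.
  have : 0 < r / 4 ^+ k by rewrite divr_gt0// exprn_gt0.
  lra.
pose inc (p : 'I_M * 'I_M) w := xi p.2 w - xi p.1 w.
have Sinc p : S (inc p) by exact: (gaussian_spaceB GS).
pose F c w := expR (theta * xi c w - theta ^+ 2 * var (xi c) / 2).
pose G c k p w := expR (theta * xi c w - theta ^+ 2 * var (xi c) / 2 +
  theta / wt k * (inc p w - theta * covar (xi c) (inc p)) - b k).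
pose W := \sum_(k < K) wt k.
(* [X c] dominates, up to the factor exp(D), every exp(theta xi_g) whose chain starts at [c], and it
   has mean at most 1. *)
pose X c w := (1 - W) * F c w + \sum_(k < K) wt k * \sum_(p | p \in E k) G c k p w.
pose D := theta ^+ 2 * sigma2 / 2 + \sum_(k < K) wt k * b k.
have GE c k p w : G c k p w = F c w * expR (theta / wt k * (inc p w - theta * covar (xi c) (inc p)) - b k).
  by rewrite /F /G -expRD; congr expR; ring.
have F0 c w : 0 <= F c w by exact: expR_ge0.
have G0 c k p w : 0 <= G c k p w by exact: expR_ge0.
have W0 : 0 <= 1 - W by rewrite subr_ge0.
have X0 c w : 0 <= X c w.
  rewrite addr_ge0 ?mulr_ge0// sumr_ge0// => k _.
  by rewrite mulr_ge0 ?(ltW (wt0 _))// sumr_ge0.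
have ptwise g w : expR (theta * xi g w) <= expR D * \sum_(c in N 0%N) X c w.
  set c := pi 0%N g.
  apply: (@le_trans _ _ (expR D * X c w)); last first.
    apply: ler_wpM2l; first exact: expR_ge0.
    rewrite (bigD1 c) ?piN//= lerDl sumr_ge0//.
  pose e k := (pi k g, pi k.+1 g).
  pose A (k : 'I_K) := theta / wt k * (inc (e k) w - theta * covar (xi c) (inc (e k))) - b k.
  have XA : F c w * expR (\sum_(k < K) wt k * A k) <= X c w.
    apply: (@le_trans _ _ (F c w * (1 - W + \sum_(k < K) wt k * expR (A k)))).
      apply: ler_wpM2l => //; apply: expR_jensen => // k; exact: ltW.
    rewrite mulrDr [F c w * (1 - W)]mulrC lerD2l mulr_sumr; apply: ler_sum => k _.
    rewrite mulrCA; apply: ler_wpM2l; first exact: ltW.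
    rewrite (bigD1 (e k)) ?piE//= GE -/(A k) lerDl sumr_ge0//.
  apply: le_trans (ler_wpM2l (expR_ge0 D) XA).
  rewrite /F -!expRD ler_expR.
  have tel n : (n <= K)%N -> \sum_(k < n) (inc (e k) w) = xi (pi n g) w - xi c w.
    elim: n => [|n IH] nK; first by rewrite big_ord0 subrr.
    by rewrite big_ord_recr /= IH ?(ltnW nK)// /inc /e /=; ring.
  have telc n : (n <= K)%N -> \sum_(k < n) covar (xi c) (inc (e k)) =
       covar (xi c) (xi (pi n g)) - covar (xi c) (xi c).
    elim: n => [|n IH] nK; first by rewrite big_ord0 subrr.
    rewrite big_ord_recr /= IH ?(ltnW nK)// (covarC P _ (inc _)) (covarBl GS)//.
    by rewrite /e /= !(covarC P _ (xi c)); ring.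
  have piK : pi K g = g by rewrite /pi eqxx.
  have sumA : \sum_(k < K) wt k * A k = theta * (xi g w - xi c w) -
     theta ^+ 2 * (covar (xi c) (xi g) - var (xi c)) - \sum_(k < K) wt k * b k.
    rewrite -piK -(tel K (leqnn K)) -(covar_var P (xi c)) -(telc K (leqnn K)).
    rewrite !mulr_sumr -!sumrB; apply: eq_bigr => k _.
    by rewrite /A; field; rewrite gt_eqF.
  (* It remains to bound cov(xi_c, xi_g) - var(xi_c) / 2 by sigma2 / 2; nonnegativity of the
     variance of xi_c - xi_g bounds it by var(xi_g) / 2. This keeps the leading term free of any
     error from the net. *)
  rewrite sumA /D.
  have := var_ge0 P (fun w => xi c w - xi g w); rewrite (varB GS)//.
  have := vs g; have : 0 < theta ^+ 2 by rewrite exprn_gt0.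
  move: (theta ^+ 2) (covar _ _) (var (xi c)) (var (xi g)) => T cv vc vg T0 h1 h2.
  have : 0 <= T * (sigma2 / 2 - (cv - vc / 2)) by apply: mulr_ge0; [exact: ltW|lra].
  lra.
have mF c : measurable_fun setT (F c).
  apply: measurableT_comp => //; apply: measurable_funB => //.
  by apply: measurable_funM => //; exact: SM.
have mG c k p : measurable_fun setT (G c k p).
  apply: measurableT_comp => //; apply: measurable_funB => //; apply: measurable_funD.
    apply: measurable_funB => //.
    by apply: measurable_funM => //; exact: SM.
  apply: measurable_funM => //; apply: measurable_funB => //; exact: SM.
have iF c : (\int[P]_w (F c w)%:E = 1)%E.
  have := @tilt_integral (xi c) (xi c) theta 0 0 (Sxi c) (Sxi c).
  rewrite expr0n /= !mul0r subr0 expR0 => <-; apply: eq_integral => w _.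
  by rewrite mul0r addr0 subr0.
have iG c (k : 'I_K) p : p \in E k -> (\int[P]_w (G c k p w)%:E <= (expR (- (L k + L k.+1)))%:E)%E.
  move=> /and3P[_ _ pd]; rewrite /G tilt_integral// lee_fin ler_expR.
  have pd' : var (inc p) <= 4 * (r / 4 ^+ k) by move: pd; rewrite (dist2C GS Sxi).
  have q0 : 0 <= (theta / wt k) ^+ 2 by exact: sqr_ge0.
  have := ler_wpM2l q0 pd'; rewrite /b.
  have -> : (theta / wt k) ^+ 2 * (4 * (r / 4 ^+ k)) = 2 * (2 * theta ^+ 2 * (r / 4 ^+ k) / wt k ^+ 2).
    by rewrite exprMn exprVn; ring.
  lra.
have mX c : measurable_fun setT (X c).
  apply: measurable_funD; first exact: measurable_funM.
  apply: measurable_sum => k; apply: measurable_funM => //.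
  have -> : (fun x => \sum_(p | p \in E k) G c k p x) =
     (fun x => \sum_(p <- enum (E k)) G c k p x).
    by apply/funext => x; rewrite big_enum.
  exact: measurable_sum.
have iX c : (\int[P]_w (X c w)%:E <= 1)%E.
  rewrite (eq_integral (fun w => ((1 - W)%:E * (F c w)%:E + \sum_(k < K) ((wt k)%:E *
      \sum_(p <- enum (E k)) (G c k p w)%:E))%E)); last first.
    move=> w _; rewrite /X EFinD EFinM -sumEFin; congr (_ + _)%E.
    by apply: eq_bigr => k _; rewrite EFinM sumEFin big_enum.
  have mGe k p c' : measurable_fun setT (fun w => (G c' k p w)%:E).
    by apply/measurable_EFinP; exact: mG.
  have mSG k c' : measurable_fun setT (fun w => (\sum_(p <- enum (E k)) (G c' k p w)%:E)%E).
    by apply: emeasurable_sum => p.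
  rewrite ge0_integralD//; last 4 first.
  - by move=> w _; rewrite mule_ge0 ?lee_fin.
  - by apply: measurable_funeM; apply/measurable_EFinP.
  - move=> w _; apply: sume_ge0 => k _; apply: mule_ge0; first by rewrite lee_fin ltW.
    by apply: sume_ge0 => p _; rewrite lee_fin.
  - by apply: emeasurable_sum => k; apply: measurable_funeM.
  rewrite ge0_integralZl//; last 2 first.
  - by apply/measurable_EFinP.
  - by move=> w _; rewrite lee_fin.
  rewrite iF mule1 ge0_integral_sum//; last 2 first.
  - by move=> k; apply: measurable_funeM.
  - move=> k w _; apply: mule_ge0; first by rewrite lee_fin ltW.
    by apply: sume_ge0 => p _; rewrite lee_fin.
  apply: (@le_trans _ _ ((1 - W)%:E + \sum_(k < K) (wt k)%:E)%E); last first.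
    by rewrite sumEFin -EFinD lee_fin /W; lra.
  rewrite leeD2l//; apply: lee_sum => k _.
  rewrite ge0_integralZl//; last 2 first.
  - by move=> w _; apply: sume_ge0 => p _; rewrite lee_fin.
  - by rewrite lee_fin ltW.
  rewrite -[leRHS]mule1; apply: lee_wpmul2l; first by rewrite lee_fin ltW.
  rewrite ge0_integral_sum//; last by move=> p w _; rewrite lee_fin.
  rewrite big_enum /=.
  apply: (@le_trans _ _ (\sum_(p | p \in E k) (expR (- (L k + L k.+1)))%:E)%E).
    by apply: lee_sum => p pE; exact: iG.
  rewrite sumEFin lee_fin sumr_const -[leLHS]mulr_natl expRN ler_pdivrMr ?expR_gt0// mul1r.
  have cE : (#|E k| <= #|N k| * #|N k.+1|)%N.
    rewrite -cardsX; apply: subset_leq_card; apply/fintype.subsetP => -[i j].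
    by rewrite !inE /= => /and3P[-> -> _].
  apply: (@le_trans _ _ (#|N k|%:R * #|N k.+1|%:R)); first by rewrite -natrM ler_nat.
  rewrite expRD; apply: ler_pM => //; apply: card => //; exact: ltnW.
have mXe c : measurable_fun setT (fun w => (X c w)%:E) by exact/measurable_EFinP.
apply: (@le_trans _ _ (\int[P]_w ((expR (D - theta * lambda))%:E *
   \sum_(c <- enum (N 0%N)) (X c w)%:E))%E); last first.
  rewrite ge0_integralZl//; last 2 first.
  - exact: emeasurable_sum.
  - by move=> w _; apply: sume_ge0 => c _; rewrite lee_fin.
  rewrite ge0_integral_sum//; last by move=> c w _; rewrite lee_fin.
  have -> : - theta * lambda + theta ^+ 2 * sigma2 / 2 + L 0%N + \sum_(k < K) wt k * b k =
    (D - theta * lambda) + L 0%N by rewrite /D; ring.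
  rewrite [in leRHS]expRD EFinM; apply: lee_wpmul2l => //.
  apply: (@le_trans _ _ (\sum_(c <- enum (N 0%N)) 1)%E).
    by apply: lee_sum => c _; exact: iX.
  rewrite sumEFin big_enum/= lee_fin sumr_const; exact: card.
rewrite -[X in (X <= _)%E]mul1e -(integral_cst P (measurable_exceed lambda)).
rewrite integral_mkcond.
apply: ge0_le_integral => //.
- by move=> w _; rewrite patchE; case: ifP.
- apply/(measurable_restrictT _ _).1 => //; exact: measurable_exceed.
- by apply: measurable_funeM; exact: emeasurable_sum.
- move=> w _; rewrite patchE; case: ifPn => [|_]; last first.
    rewrite mule_ge0 ?lee_fin ?expR_ge0// sume_ge0// => c _.
    by rewrite lee_fin.
  rewrite inE => -[g gl]; rewrite sumEFin -EFinM lee_fin big_enum /=.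
  rewrite expRB mulrAC ler_pdivlMr ?expR_gt0// mul1r.
  by apply: le_trans (ptwise g w); rewrite ler_expR ler_wpM2l ?ltW.
Qed.

End chaining.

(** * Hahn-Banach and a countable norming family *)

Section norming_functionals.
Context {R : realType} {E : normedModType R}.
Implicit Types (x y : E) (r s a : R).

Lemma dual_elt_of_norm_le1 (g : E -> R) :
  (forall a x y, g (a *: x + y) = a * g x + g y) -> dual_norm_le1 g -> dual_elt g.
Proof.
move=> glin gle; split=> // x; apply/cvgrPdist_le => e e0; near=> y.
have -> : g x - g y = g (x - y).
  by rewrite [x - y]addrC -(scaleN1r y) glin mulN1r addrC.
apply: le_trans (gle _) _; near: y; exact: cvgr_dist_le.
Unshelve. all: by end_near. Qed.

(* The graphs ordered by Zorn's lemma; the last clause lets the empty set,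
   the union of the empty chain, be one of them. *)
Definition dominated_graph (x0 : E) (G : set (E * R)) : Prop :=
  [/\ forall a x r y s, G (x, r) -> G (y, s) -> G (a *: x + y, a * r + s),
      forall x r, G (x, r) -> r <= `|x| &
      G !=set0 -> G (x0, `|x0|)].

Lemma dominated_graph_line x0 :
  dominated_graph x0 [set p | exists t : R, p = (t *: x0, t * `|x0|)].
Proof.
split.
- move=> a x r y s [t [-> ->]] [u [-> ->]]; exists (a * t + u).
  by rewrite scalerDl scalerA mulrDl mulrA.
- move=> x r [t [-> ->]]; rewrite normrZ ler_wpM2r//; exact: ler_norm.
- by move=> _; exists 1; rewrite scale1r mul1r.
Qed.

Lemma dominated_graph_maximal x0 : exists A, dominated_graph x0 A /\
  forall B, A `<` B -> ~ dominated_graph x0 B.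
Proof.
apply: Zorn_bigcup => F FP Ftot; split.
- move=> a x r y s [G FG Gx] [H FH Hy].
  have [GH|HG] := Ftot _ _ FG FH.
    by exists H => //; have [+ _ _] := FP _ FH; apply => //; exact: GH.
  by exists G => //; have [+ _ _] := FP _ FG; apply => //; exact: HG.
- by move=> x r [G FG Gx]; have [_ + _] := FP _ FG; apply.
- move=> [p [G FG Gp]]; exists G => //.
  by have [_ _] := FP _ FG; apply; exists p.
Qed.

(** The one-dimensional extension step: the value at [y] must lie above all r - |x - y| and below
    all |x + y| - r, and the supremum [c] of the former is a choice. Scaling by 1/|t| handles
    multiples of [y] of both signs. *)
Lemma dominated_graph_extend x0 A y : dominated_graph x0 A -> A (x0, `|x0|) ->
  exists B, [/\ dominated_graph x0 B, A `<=` B & exists c, B (y, c)].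
Proof.
move=> [Alin Adom _] A0.
have Azero : A (0, 0).
  by have := Alin (-1) _ _ _ _ A0 A0; rewrite scaleN1r addNr mulN1r addNr.
have Ascale a x r : A (x, r) -> A (a *: x, a * r).
  by move=> Ax; have := Alin a _ _ _ _ Ax Azero; rewrite !addr0.
pose LL := [set q | exists x r, A (x, r) /\ q = r - `|x - y|].
have LU q x' r' : LL q -> A (x', r') -> q <= `|x' + y| - r'.
  move=> [x [r [Ax ->]]] Ax'.
  have := Adom _ _ (Alin 1 _ _ _ _ Ax Ax'); rewrite scale1r mul1r.
  have := ler_normD (x - y) (x' + y).
  have -> : x - y + (x' + y) = x + x' by rewrite addrACA addNr addr0.
  lra.
have LLsup : has_sup LL.
  split; first by exists (0 - `|0 - y|), 0, 0.
  by exists (`|0 + y| - 0) => q Lq; exact: LU Lq Azero.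
pose c := sup LL.
have cl x r : A (x, r) -> r - `|x - y| <= c.
  by move=> Ax; apply: (sup_upper_bound LLsup); exists x, r.
have cu x r : A (x, r) -> c <= `|x + y| - r.
  by move=> Ax; apply: (ge_sup LLsup.1) => q Lq; exact: LU Lq Ax.
exists [set p | exists x r t, A (x, r) /\ p = (x + t *: y, r + t * c)]; split.
- split.
  + move=> a u1 s1 u2 s2 [x [r [t [Ax [-> ->]]]]] [x' [r' [t' [Ax' [-> ->]]]]].
    exists (a *: x + x'), (a * r + r'), (a * t + t'); split; first exact: Alin.
    by congr pair; [rewrite scalerDr scalerDl scalerA addrACA|ring].
  + move=> u s1 [x [r [t [Ax [-> ->]]]]].
    have [t0|t0|->] := ltgtP t 0; last first.
    * by rewrite scale0r mul0r !addr0; exact: Adom.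
    * have := cu _ _ (Ascale t^-1 _ _ Ax).
      have -> : t^-1 *: x + y = t^-1 *: (x + t *: y).
        by rewrite scalerDr scalerA mulVf ?gt_eqF// scale1r.
      rewrite normrZ gtr0_norm ?invr_gt0// -(ler_pM2l t0).
      by rewrite mulrBr !mulrA mulfV ?gt_eqF// !mul1r; lra.
    * have s0 : 0 < - t by lra.
      have := cl _ _ (Ascale (- t)^-1 _ _ Ax).
      have -> : (- t)^-1 *: x - y = (- t)^-1 *: (x + t *: y).
        rewrite scalerDr scalerA invrN mulNr mulVf ?lt_eqF// scaleN1r//.
      rewrite normrZ gtr0_norm ?invr_gt0// -(ler_pM2l s0).
      by rewrite mulrBr !mulrA mulfV ?gt_eqF// !mul1r; lra.
  + move=> _; exists x0, `|x0|, 0; split => //.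
    by rewrite scale0r mul0r !addr0.
- move=> [x r] Ax; exists x, r, 0; split => //.
  by rewrite scale0r mul0r !addr0.
- by exists c, 0, 0, 1; split => //; rewrite scale1r mul1r !add0r.
Qed.

Lemma norming_functional x0 : exists g : E -> R,
  [/\ dual_elt g, dual_norm_le1 g & g x0 = `|x0|].
Proof.
have [A [PA Amax]] := dominated_graph_maximal x0.
have [Alin Adom A00] := PA.
have A0 : A (x0, `|x0|).
  apply: A00; apply/set0P/eqP => Ae.
  apply: (Amax _ _ (dominated_graph_line x0)); rewrite Ae.
  split; first by move=> p.
  by move=> /(_ (x0, `|x0|)); apply; exists 1; rewrite scale1r mul1r.
have full y : exists r, A (y, r).
  have [B [PB AB [c Bc]]] := dominated_graph_extend y PA A0.
  apply: contrapT => nA; apply: (Amax B) => //; split => //.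
  by move=> /(_ _ Bc) Ay; apply: nA; exists c.
have [g Hg] := choice full.
(* Single-valuedness is not built into [dominated_graph]; it follows from linearity and domination
   at the vector 0. *)
have le x r s : A (x, r) -> A (x, s) -> s <= r.
  move=> Ar As; have := Adom _ _ (Alin (-1) _ _ _ _ Ar As).
  by rewrite scaleN1r addNr normr0; lra.
have uniq x r : A (x, r) -> g x = r.
  by move=> Ar; apply/eqP; rewrite eq_le !(le x)//; exact: Hg.
have glin a x y : g (a *: x + y) = a * g x + g y.
  by apply: uniq; apply: Alin; exact: Hg.
have g0 : g 0 = 0.
  by have := glin (-1) 0 0; rewrite scaler0 addr0; lra.
have gle : dual_norm_le1 g.
  move=> x; rewrite ler_norml; apply/andP; split; last exact: Adom (Hg x).
  have := Adom _ _ (Hg (- x)); rewrite normrN.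
  have := glin (-1) x 0; rewrite scaleN1r !addr0 g0; lra.
exists g; split => //; [exact: dual_elt_of_norm_le1|exact: uniq].
Qed.

Lemma norming_sequence : separable_space E -> exists g : nat -> E -> R,
  [/\ forall n, dual_elt (g n), forall n, dual_norm_le1 (g n) &
      forall x (l : R), l < `|x| -> exists n, l < g n x].
Proof.
move=> [D [/countable_injP[f finj] Ddense]].
have h n : exists e : E, forall x, D x -> f x = n -> e = x.
  have [[x [Dx fx]]|nx] := pselect (exists x, D x /\ f x = n).
    exists x => y Dy fy; apply: finj; rewrite ?inE//; congruence.
  by exists 0 => x Dx fx; exfalso; apply: nx; exists x.
have [e He] := choice h.
have [g Hg] := choice (fun n => norming_functional (e n)).
exists g; split; [by move=> n; have [] := Hg n|by move=> n; have [] := Hg n|].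
move=> x l lx.
(* If [y] is in D and g norms [y], then g(x) >= |y| - |x - y| >= |x| - 2 |x - y|, so a distance
   below one third of the gap leaves g(x) above [l]. *)
have d0 : 0 < (`|x| - l) / 3 by rewrite divr_gt0// subr_gt0.
have : closure D x by rewrite Ddense.
move=> /(_ _ (nbhsx_ballx x _ d0))[y [Dy]].
rewrite -ball_normE /= => xy.
have ey : e (f y) = y by exact: He.
exists (f y); have [[glin _] gle gy] := Hg (f y); rewrite ey in gy.
have gxy : g (f y) (x - y) = g (f y) x - g (f y) y.
  by rewrite [x - y]addrC -(scaleN1r y) glin mulN1r addrC.
have := gle (x - y); rewrite gxy gy ler_norml.
have := lerB_dist x y => h1 /andP[h2 h3].
lra.
Qed.

End norming_functionals.

(** * Elementary growth estimates *)

Section growth_estimates.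
Context {R : realType}.
Implicit Types (a b c l s t y : R).

Lemma powR_expR (x p : R) : 0 < x -> x `^ p = expR (p * ln x).
Proof. by move=> x0; rewrite /powR gt_eqF. Qed.

Lemma powR1D_le_expR s eta : 0 <= s -> 0 < eta ->
  exists2 C, 1 <= C & forall y, 0 <= y -> (1 + y) `^ s <= C * expR (eta * y).
Proof.
(* The scale [D] satisfies s / D <= eta, and 1 + y <= D exp(y / D) because D >= 1. *)
move=> s0 e0; pose D := 1 + (s + 1) / eta.
have D1 : 1 <= D by rewrite lerDl divr_ge0 ?ltW//; lra.
have D0 : 0 < D by lra.
exists (D `^ s); first by rewrite -(powRr0 D) ler_powR.
move=> y y0.
apply: (@le_trans _ _ ((D * expR (y / D)) `^ s)).
  apply: ge0_ler_powR => //; rewrite ?nnegrE; first lra.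
    by rewrite mulr_ge0 ?expR_ge0// ltW.
  have := expR_ge1Dx (y / D); rewrite -(ler_pM2l D0) mulrDr mulr1 mulrCA divff ?gt_eqF// mulr1.
  lra.
rewrite powRM ?expR_ge0 ?(ltW D0)// ler_pM2l ?powR_gt0//.
rewrite -expRM ler_expR mulrC mulrA ler_pdivrMr// mulrAC; apply: ler_wpM2r => //.
rewrite /D mulrDr mulr1 mulrCA divff ?gt_eqF//; lra.
Qed.

(** Both b / a and a / b are at most 1 + |b - a|, whatever the sign of [beta]. Applied to a = |log
    eps|, it says that the logarithmic factor distorts the geometric growth between scales by an
    arbitrarily small rate [eta] only. *)
Lemma powR_slowly_varying (beta eta : R) : 0 < eta ->
  exists2 C, 1 <= C & forall a b, 1 <= a -> 1 <= b ->
    b `^ beta <= C * a `^ beta * expR (eta * `|b - a|).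
Proof.
move=> e0; have [C C1 HC] := powR1D_le_expR (normr_ge0 beta) e0.
exists C => // a b a1 b1.
set y := `|b - a|; have y0 : 0 <= y by exact: normr_ge0.
suff h : b `^ beta <= (1 + y) `^ `|beta| * a `^ beta.
  rewrite mulrAC; apply: (le_trans h); apply: ler_wpM2r; first exact: powR_ge0.
  exact: HC.
have a0 : 0 < a by lra.
have b0 : 0 < b by lra.
have y1 : 0 < 1 + y by lra.
have ub : b <= (1 + y) * a.
  have : b - a <= y by exact: ler_norm.
  nra.
have ua : a <= (1 + y) * b.
  have : - (b - a) <= y by rewrite /y -normrN; exact: ler_norm.
  nra.
rewrite !powR_expR// -expRD ler_expR -lerBlDr -mulrBr.
apply: (le_trans (ler_norm _)); rewrite normrM; apply: ler_wpM2l => //.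
rewrite ler_norml; apply/andP; split.
  by rewrite lerNl opprB lerBlDr -lnM// ler_ln// posrE mulr_gt0.
by rewrite lerBlDr -lnM// ler_ln// posrE mulr_gt0.
Qed.

Lemma expR_dominates s a c : 0 < a ->
  exists2 l0, 1 <= l0 & forall l, l0 <= l -> c * l `^ s <= expR (a * l).
Proof.
move=> a0; have a20 : 0 < a / 2 by rewrite divr_gt0.
have [C C1 HC] := powR1D_le_expR (normr_ge0 s) a20.
pose A := 1 + `|c| * C.
have A1 : 1 <= A by rewrite lerDl mulr_ge0//; lra.
have lA : 0 <= ln A by exact: ln_ge0.
have a2 : 0 <= 2 / a by rewrite divr_ge0// ltW.
exists (1 + 2 / a * ln A); first by rewrite lerDl mulr_ge0.
move=> l ll0.
have l1 : 1 <= l by apply: le_trans ll0; rewrite lerDl mulr_ge0.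
have l0 : 0 < l by lra.
apply: (@le_trans _ _ (`|c| * (1 + l) `^ `|s|)).
  apply: (@le_trans _ _ (`|c| * l `^ s)).
    by apply: ler_wpM2r; [exact: powR_ge0|exact: ler_norm].
  apply: ler_wpM2l => //; rewrite !powR_expR ?ler_expR//; last lra.
  have ll : 0 <= ln l by exact: ln_ge0.
  apply: (@le_trans _ _ (`|s| * ln l)); first by apply: ler_wpM2r => //; exact: ler_norm.
  by apply: ler_wpM2l => //; rewrite ler_ln ?posrE//; lra.
apply: (@le_trans _ _ (A * expR (a / 2 * l))).
  apply: (@le_trans _ _ (`|c| * (C * expR (a / 2 * l)))).
    by apply: ler_wpM2l => //; apply: HC; exact: ltW.
  rewrite mulrA; apply: ler_wpM2r; first exact: expR_ge0.
  by rewrite /A lerDr.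
rewrite -[X in X * _](lnK (_ : A \is Num.pos)) ?posrE; last lra.
rewrite -expRD ler_expR.
have : ln A <= a / 2 * l.
  have : 2 / a * ln A <= l by lra.
  rewrite mulrAC ler_pdivrMr//; lra.
lra.
Qed.


Lemma geometric_sum_le (q : R) n : 0 <= q -> q < 1 ->
  \sum_(i < n) q ^+ i <= (1 - q)^-1.
Proof.
move=> q0 q1; have d : 0 < 1 - q by rewrite subr_gt0.
rewrite -[leRHS]mul1r ler_pdivlMr//.
suff -> : (\sum_(i < n) q ^+ i) * (1 - q) = 1 - q ^+ n.
  by rewrite lerBlDr lerDl exprn_ge0.
elim: n => [|n IH]; first by rewrite big_ord0 mul0r expr0 subrr.
by rewrite big_ord_recr /= mulrDl IH exprSr; ring.
Qed.

Lemma geometric_sum_rev_le (q : R) n : 0 <= q -> q < 1 ->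
  \sum_(i < n) q ^+ (n - i.+1) <= (1 - q)^-1.
Proof.
move=> q0 q1; rewrite (reindex_inj rev_ord_inj) /=.
rewrite (eq_bigr (fun i : 'I_n => q ^+ i)); first exact: geometric_sum_le.
by move=> i _; rewrite subnSK// subKn// ltnW.
Qed.

Lemma geometric_sum_gt1_le (Q : R) n : 1 < Q ->
  \sum_(i < n) Q ^+ i.+1 <= Q / (Q - 1) * Q ^+ n.
Proof.
move=> Q1; have d : 0 < Q - 1 by rewrite subr_gt0.
rewrite mulrAC ler_pdivlMr//.
suff -> : (\sum_(i < n) Q ^+ i.+1) * (Q - 1) = Q * Q ^+ n - Q by lra.
elim: n => [|n IH]; first by rewrite big_ord0 mul0r expr0; ring.
by rewrite big_ord_recr /= mulrDl IH !exprS; ring.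
Qed.

End growth_estimates.

(** * Calibration of scales and small ball radii *)

Section entropy_levels.
Context {R : realType}.
Context (c0 alpha beta sigma : R).
Context (c00 : 0 < c0) (alpha0 : 0 < alpha).

(** The argument is l = log lambda. The value psi solves psi^(alpha + 1) = lambda^alpha l^beta,
    which makes the small ball exponent at radius psi / lambda again of order psi. *)
Definition growth (l : R) : R :=
  expR l `^ (alpha / (alpha + 1)) * l `^ (beta / (alpha + 1)).

(* Passing from the scale r / 4^n to r / 4^(n+1) corresponds to
   shrinking the small ball radius by exp(- 2 level_step); its exponent
   eps^(- alpha) |log eps|^beta then grows by a factor of at most level_ratio < 4. *)
Definition level_step : R := ln 2 / (alpha + 2).

Definition level_ratio : R := expR (2 * (alpha + 1) * level_step).

Definition small_ball_exponent (e : R) : R := c0 * e `^ (- alpha) * `|ln e| `^ beta.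

Let tau := level_step.
Let ln2_gt0 : 0 < ln 2 :> R. Proof. by apply: ln_gt0; lra. Qed.
Let tau0 : 0 < tau. Proof. by have a0 := alpha0; rewrite divr_gt0//; lra. Qed.
Let tauE : (alpha + 2) * tau = ln 2. Proof. by have a0 := alpha0; rewrite /tau /level_step mulrC divfK// gt_eqF//; lra. Qed.

Lemma expR_level n : expR (2 * (alpha + 2) * tau * n%:R) = 4 ^+ n.
Proof.
rewrite -[2 * _ * _]mulrA tauE expRM_natr; congr (_ ^+ _).
have -> : 2 * ln 2 = ln 2 + ln 2 :> R by ring.
by rewrite expRD !lnK ?posrE//; lra.
Qed.

Lemma level_ratio_gt1 : 1 < level_ratio.
Proof.
by have a0 := alpha0; rewrite expR_gt1; apply: mulr_gt0 => //; apply: mulr_gt0 => //; lra.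
Qed.

Lemma level_ratio_lt4 : level_ratio < 4.
Proof.
have a0 := alpha0; have := expR_level 1; rewrite expr1 mulr1 => <-; rewrite ltr_expR ltr_pM2r//; lra.
Qed.

Lemma small_ball_exponentE a : 0 < a ->
  small_ball_exponent (expR (- a)) = c0 * expR (alpha * a) * a `^ beta.
Proof.
move=> a0; rewrite /small_ball_exponent powR_expR ?expR_gt0// expRK normrN gtr0_norm//.
by congr (_ * expR _ * _); ring.
Qed.

Lemma growthE l : 0 < l ->
  growth l = expR (alpha / (alpha + 1) * l + beta / (alpha + 1) * ln l).
Proof. by move=> l0; rewrite /growth !powR_expR ?expR_gt0// expRK -expRD. Qed.

(** Any multiple of log lambda is eventually below the error term; this pays for the coarse levels
    at which the radius is cut down. *)
Lemma growth_dominates (A : R) : exists2 l0, 1 <= l0 &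
  forall l, l0 <= l -> 1 <= growth l /\ A * l <= growth l.
Proof.
have a0 : 0 < alpha / (alpha + 1) by have a0 := alpha0; rewrite divr_gt0//; lra.
have [l0 l01 H] := @expR_dominates R (1 - beta / (alpha + 1)) _ (1 + `|A|) a0.
exists l0 => // l ll0; have l1 : 1 <= l by lra.
have lp : 0 < l by lra.
suff h : (1 + `|A|) * l <= growth l.
  have := ler_norm A; have := normr_ge0 A => n0 nA.
  by split; nra.
have := H l ll0; rewrite powR_expR// mulrBl mul1r expRB lnK ?posrE// mulrA.
by rewrite ler_pdivrMr ?expR_gt0// -expRD -growthE.
Qed.

(** Here exp(- a) is the radius psi / lambda. Once |beta ln l| <= l / 2, the number [a] lies between
    1/2 and 3/2 of l / (alpha + 1), so a^beta is comparable to l^beta; the sum u^beta + v^beta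
    covers both signs of [beta]. *)
Lemma small_ball_exponent_growth : exists2 B, 0 < B &
  exists2 l0, 1 <= l0 & forall l, l0 <= l ->
  let a := l / (alpha + 1) - beta / (alpha + 1) * ln l in
  [/\ growth l / expR l = expR (- a), l / (2 * (alpha + 1)) <= a &
      small_ball_exponent (expR (- a)) <= B * growth l].
Proof.
have a0 := alpha0; have a1 : 0 < alpha + 1 by lra.
have a1n : alpha + 1 != 0 by rewrite gt_eqF.
pose u := 1 / (2 * (alpha + 1)); pose v := 3 / (2 * (alpha + 1)).
have u0 : 0 < u by rewrite divr_gt0// mulr_gt0.
have v0 : 0 < v by rewrite divr_gt0// mulr_gt0.
have uv : u <= v by rewrite ler_pM2r ?invr_gt0 ?mulr_gt0//; lra.
have [l0 l01 H] := @expR_dominates R (2 * `|beta|) 1 1 ltr01.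
exists (c0 * (u `^ beta + v `^ beta)); first by rewrite mulr_gt0// addr_gt0// powR_gt0.
exists l0 => // l ll0 a.
have lp : 0 < l by lra.
have bl : `|beta * ln l| <= l / 2.
  have := H l ll0; rewrite mul1r mul1r powR_expR// ler_expR.
  have ll : 0 <= ln l by apply: ln_ge0; lra.
  rewrite normrM (ger0_norm ll); lra.
have aE : a = (l - beta * ln l) / (alpha + 1) by rewrite /a; field; exact: a1n.
move: bl; rewrite ler_norml => /andP[b1 b2].
have al : u * l <= a.
  by rewrite aE /u ler_pdivlMr// (_ : _ * l * _ = l / 2); [lra|field; exact: a1n].
have au : a <= v * l.
  by rewrite aE /v ler_pdivrMr// (_ : _ * l * _ = 3 / 2 * l); [lra|field; exact: a1n].
have ap : 0 < a by apply: lt_le_trans al; rewrite mulr_gt0.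
split.
- by rewrite growthE// -expRB; congr expR; rewrite /a; field; exact: a1n.
- by apply: le_trans al; rewrite /u mul1r mulrC.
rewrite small_ball_exponentE// -!mulrA ler_pM2l//.
have h : a `^ beta <= (u `^ beta + v `^ beta) * l `^ beta.
  have [b0|b0] := ltP beta 0.
    apply: (@le_trans _ _ (u `^ beta * l `^ beta)); last first.
      by rewrite ler_wpM2r ?powR_ge0// lerDl powR_ge0.
    rewrite -(powRM _ (ltW u0) (ltW lp)) (powR_expR _ ap) (powR_expR _ (mulr_gt0 u0 lp)) ler_expR.
    by rewrite (ler_wnM2l (ltW b0))// ler_ln// posrE mulr_gt0.
  apply: (@le_trans _ _ (v `^ beta * l `^ beta)); last first.
    by rewrite ler_wpM2r ?powR_ge0// lerDr powR_ge0.
  rewrite -(powRM _ (ltW v0) (ltW lp)); apply: ge0_ler_powR => //; rewrite nnegrE ?(ltW ap)//.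
  by rewrite ltW// mulr_gt0.
apply: (@le_trans _ _ (expR (alpha * a) * ((u `^ beta + v `^ beta) * l `^ beta))).
  by rewrite ler_wpM2l ?expR_ge0.
rewrite mulrCA ler_wpM2l ?addr_ge0 ?powR_ge0// growthE// (powR_expR _ lp) -expRD ler_expR.
rewrite /a le_eqVlt; apply/orP; left; apply/eqP; field; exact: a1n.
Qed.

(* With psi = growth l and r = psi / expR l ^+ 2, the radius expR (- a) balances the two
   contributions at scale r; at level n, whose scale is r * 4 ^ (J - n), it is rescaled
   by expR (- y), but kept below expR (- e1), where the small ball hypothesis applies. *)
Lemma level_cost_le (B1 C eta e1 a psi l : R) (J n : nat) :
  let y := 2 * tau * (n%:R - J%:R) in
  let A := Num.max (a + y) e1 in
  0 < B1 -> 1 <= C -> 0 < eta ->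
  (forall a b, 1 <= a -> 1 <= b ->
     b `^ beta <= C * a `^ beta * expR (eta * `|b - a|)) ->
  1 <= e1 -> e1 <= a -> 0 < psi -> psi / expR l = expR (- a) ->
  small_ball_exponent (expR (- a)) <= B1 * psi ->
  small_ball_exponent (expR (- A)) +
    364 * expR (- A) ^+ 2 / (psi / expR l ^+ 2 * 4 ^+ J / 4 ^+ n) <=
  (C * B1 + 364) * psi * expR (alpha * y + eta * `|y|) +
    (if (n < J)%N then small_ball_exponent (expR (- e1)) else 0).
Proof.
move=> y A B10 C1 eta0 HC e11 ae psi0 epsE phia.
have a_1 : 1 <= a := le_trans e11 ae.
have CB0 : 0 < C * B1 by apply: mulr_gt0 => //; exact: lt_le_trans ltr01 C1.
set Phi := small_ball_exponent (expR (- e1)).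
have Phi0 : 0 <= Phi.
  by rewrite /Phi /small_ball_exponent !mulr_ge0 ?powR_ge0// ltW.
have sq : expR (- A) ^+ 2 / (psi / expR l ^+ 2 * 4 ^+ J / 4 ^+ n) <=
    psi * expR (alpha * y + eta * `|y|).
  apply: (@le_trans _ _ (psi * expR (alpha * y))); last first.
    by rewrite ler_pM2l// ler_expR lerDl mulr_ge0// ltW.
  rewrite ler_pdivrMr; last first.
    by apply: divr_gt0; [apply: mulr_gt0; [apply: divr_gt0|]|]; rewrite ?exprn_gt0 ?expR_gt0.
  have -> : psi * expR (alpha * y) * (psi / expR l ^+ 2 * 4 ^+ J / 4 ^+ n) =
     (psi / expR l) ^+ 2 * (expR (alpha * y) * (4 ^+ J / 4 ^+ n)).
    have g1 : 4 ^+ n != 0 :> R by rewrite gt_eqF// exprn_gt0.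
    have g2 : expR l != 0 by rewrite gt_eqF// expR_gt0.
    by move: (4 ^+ J) (4 ^+ n) g1 (expR l) g2 => u v g1 w g2; field; rewrite g1 g2.
  (* As 2 (alpha + 2) tau = log 4, the squared radius exp(- 2 (a + y)) divided by the scale equals
     psi exp(alpha y), the same growth rate as that of the small ball exponent; this balance
     dictates the value of [level_step]. *)
  rewrite epsE -!expR_level -expRB -expRD -!expRM_natl -expRD ler_expR.
  have : a + y <= A by rewrite le_max lexx.
  rewrite /y; lra.
have phi : small_ball_exponent (expR (- A)) <=
   C * B1 * psi * expR (alpha * y + eta * `|y|) + (if (n < J)%N then Phi else 0).
  have pos : 0 <= C * B1 * psi * expR (alpha * y + eta * `|y|).
    apply: mulr_ge0; last exact: expR_ge0.
    by apply: mulr_ge0; exact: ltW.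
  have pot : 1 <= a + y -> small_ball_exponent (expR (- (a + y))) <=
      C * B1 * psi * expR (alpha * y + eta * `|y|).
    move=> ay; rewrite small_ball_exponentE; last lra.
    have ap : 0 < a by lra.
    rewrite small_ball_exponentE// in phia.
    apply: (@le_trans _ _ (c0 * expR (alpha * (a + y)) *
        (C * a `^ beta * expR (eta * `|y|)))).
      apply: ler_wpM2l; first by rewrite mulr_ge0 ?expR_ge0// ltW.
      have := HC a (a + y) a_1 ay.
      by have -> : a + y - a = y by ring.
    have -> : c0 * expR (alpha * (a + y)) * (C * a `^ beta * expR (eta * `|y|)) =
      C * expR (alpha * y + eta * `|y|) * (c0 * expR (alpha * a) * a `^ beta).
      by rewrite mulrDr !expRD; ring.
    have -> : C * B1 * psi * expR (alpha * y + eta * `|y|) =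
      C * expR (alpha * y + eta * `|y|) * (B1 * psi) by ring.
    apply: ler_wpM2l => //; apply: mulr_ge0; [lra|exact: expR_ge0].
  have [le1|lt1] := leP (a + y) e1.
    (* The radius is cut down. For n < J the constant [Phi] pays for it; for n >= J one has y >= 0
       and a >= e1, so that a + y = e1 and nothing has changed. *)
    have -> : A = e1 by rewrite /A max_r.
    case: ltnP => [_|Jn]; first by rewrite lerDr.
    have : 0 <= y.
      by apply: mulr_ge0; [apply: mulr_ge0 => //; exact: ltW|rewrite subr_ge0 ler_nat].
    move=> yn; have e1a : e1 = a + y by apply: le_anti; rewrite le1 andbT (le_trans ae)// lerDl.
    by rewrite addr0 {1}e1a; apply: pot; rewrite -e1a.
  have -> : A = a + y by rewrite /A max_l// ltW.
  apply: (@le_trans _ _ (C * B1 * psi * expR (alpha * y + eta * `|y|))).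
    by apply: pot; rewrite (le_trans e11)// ltW.
  by rewrite lerDl; case: ifP.
have -> : 364 * expR (- A) ^+ 2 / (psi / expR l ^+ 2 * 4 ^+ J / 4 ^+ n) =
  364 * (expR (- A) ^+ 2 / (psi / expR l ^+ 2 * 4 ^+ J / 4 ^+ n)) by rewrite mulrA.
move: sq phi.
move: (expR (alpha * y + _)) (_ / _) (small_ball_exponent _) => X Y Z sq phi.
have := ler_wpM2l (ler0n R 364) sq.
lra.
Qed.

(** Below level J the costs form a convergent geometric series, plus one constant per level; beyond
    J they grow at most by [level_ratio]. The bound [B] is fixed before [a1], so the range of
    validity of the small ball hypothesis affects only [l0]. *)
Lemma entropy_levels : exists2 B, 0 < B & forall a1, 1 <= a1 ->
  exists2 l0, 1 <= l0 & forall l, l0 <= l ->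
  1 <= growth l /\
  exists (J : nat) (eps : nat -> R),
  [/\ forall n, 0 < eps n <= expR (- a1),
      4 * sigma ^+ 2 <= growth l / expR l ^+ 2 * 4 ^+ J &
      forall k, \sum_(i < J + k) (small_ball_exponent (eps i.+1) +
        364 * eps i.+1 ^+ 2 / (growth l / expR l ^+ 2 * 4 ^+ J / 4 ^+ i.+1)) <=
        B * growth l * level_ratio ^+ k].
Proof.
have a0 := alpha0.
have [B1 B10 [l1 l11 H1]] := small_ball_exponent_growth.
(* On coarse levels (y < 0) the decay rate alpha - eta is at least alpha / 2; on fine levels alpha +
   eta <= alpha + 1, the rate built into [level_ratio]. *)
pose eta := Num.min 1 (alpha / 2).
have eta0 : 0 < eta by rewrite lt_min ltr01 divr_gt0.
have eta1 : eta <= 1 by rewrite ge_min lexx.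
have eta2 : eta <= alpha / 2 by rewrite ge_min lexx orbT.
have [C C1 HC] := powR_slowly_varying beta eta0.
pose Q := level_ratio.
pose q := expR (- (alpha * tau)).
have q0 : 0 <= q by exact: expR_ge0.
have q1 : q < 1 by rewrite expR_lt1 oppr_lt0 mulr_gt0.
have Q1 : 1 < Q by exact: level_ratio_gt1.
pose B2 := C * B1 + 364.
have CB0 : 0 < C * B1 by apply: mulr_gt0 => //; lra.
have B20 : 0 < B2 by rewrite /B2; lra.
pose B := B2 * (1 - q)^-1 + 1 + B2 * (Q / (Q - 1)).
have iq0 : 0 <= (1 - q)^-1 by rewrite invr_ge0; lra.
have iQ0 : 0 <= Q / (Q - 1) by rewrite divr_ge0//; lra.
exists B.
  have := mulr_ge0 (ltW B20) iq0; have := mulr_ge0 (ltW B20) iQ0; rewrite /B; lra.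
move=> e1 e11.
pose Phi := small_ball_exponent (expR (- e1)).
have Phi0 : 0 <= Phi.
  by rewrite /Phi /small_ball_exponent !mulr_ge0 ?powR_ge0// ltW.
have [l2 l21 H2] := growth_dominates (4 * Phi).
pose l0 := l1 + l2 + 2 * (alpha + 1) * e1 + `|ln (4 * sigma ^+ 2)|.
have p2 : 0 <= 2 * (alpha + 1) * e1 by rewrite !mulr_ge0//; lra.
have p3 := normr_ge0 (ln (4 * sigma ^+ 2)).
exists l0; first by rewrite /l0; lra.
move=> l; rewrite /l0 => ll0.
have lp : 0 < l by lra.
have [psi1 psiP] := H2 l ltac:(lra).
have := H1 l ltac:(lra).
set a := l / (alpha + 1) - beta / (alpha + 1) * ln l => /= -[epsE al phia].
split=> //.
set psi := growth l in psi1 psiP epsE phia *.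
have psi0 : 0 < psi := lt_le_trans ltr01 psi1.
have ae : e1 <= a.
  apply: le_trans al; rewrite ler_pdivlMr; last by rewrite mulr_gt0//; lra.
  rewrite mulrC; lra.
(* J >= 3 l gives 4^J >= lambda^3, hence a coarsest squared scale of at least lambda, above 4
   sigma^2; J <= 4 l keeps the total J Phi below psi. *)
pose J := (Num.truncn (3 * l)).+1.
have J1 : 3 * l <= J%:R by apply/ltW; rewrite truncnS_gt.
have J2 : J%:R <= 4 * l.
  have : (Num.truncn (3 * l))%:R <= 3 * l by rewrite truncn_le; lra.
  rewrite /J -[(Num.truncn _).+1]addn1 natrD; lra.
pose y (n : nat) := 2 * tau * (n%:R - J%:R).
pose A n := Num.max (a + y n) e1.
have A1 n : 1 <= A n by rewrite le_max e11 orbT.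
exists J, (fun n => expR (- A n)); split.
- by move=> n; rewrite expR_gt0 ler_expR lerN2 le_max lexx orbT.
- have h : expR l ^+ 3 <= 4 ^+ J.
    rewrite -expR_level -expRM_natl ler_expR.
    have t1 : 1 <= 2 * (alpha + 2) * tau.
      rewrite -mulrA tauE.
      have := expR_ge1Dx (- ln 2 : R); rewrite expRN lnK ?posrE//; lra.
    apply: (le_trans J1); rewrite -[leLHS]mul1r; apply: ler_wpM2r => //.
  apply: (@le_trans _ _ (expR l)).
    have [s0|s0] := ltP 0 (4 * sigma ^+ 2); last by apply: le_trans s0 (expR_ge0 _).
    rewrite -[leLHS]lnK ?posrE// ler_expR; apply: le_trans (ler_norm _) _; lra.
  rewrite mulrAC ler_pdivlMr ?exprn_gt0 ?expR_gt0// -exprS.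
  apply: (le_trans h); rewrite -[leLHS]mul1r; apply: ler_wpM2r => //.
have Hn n : small_ball_exponent (expR (- A n)) +
   364 * expR (- A n) ^+ 2 / (psi / expR l ^+ 2 * 4 ^+ J / 4 ^+ n) <=
   B2 * psi * expR (alpha * y n + eta * `|y n|) + (if (n < J)%N then Phi else 0).
  exact: level_cost_le.
move=> k; have Bp : 0 <= B2 * psi by apply: mulr_ge0; exact: ltW.
apply: (@le_trans _ _ (\sum_(i < J + k) (B2 * psi * expR (alpha * y i.+1 + eta * `|y i.+1|) +
    (if (i.+1 < J)%N then Phi else 0)))).
  by apply: ler_sum => i _; exact: (Hn i.+1).
rewrite big_split_ord /=.
have Qk1 : 1 <= Q ^+ k by rewrite exprn_ege1// ltW.
have lo : \sum_(i < J) (B2 * psi * expR (alpha * y i.+1 + eta * `|y i.+1|) +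
    (if (i.+1 < J)%N then Phi else 0)) <= (B2 * (1 - q)^-1 + 1) * psi.
  apply: (@le_trans _ _ (\sum_(i < J) (B2 * psi * q ^+ (J - i.+1) + Phi))).
    apply: ler_sum => i _; apply: lerD; last by case: ifP.
    apply: ler_wpM2l; first exact: Bp.
    have yE : y i.+1 = - (2 * tau * (J - i.+1)%:R).
      by rewrite /y natrB//; ring.
    have j0 : 0 <= (J - i.+1)%:R :> R by [].
    rewrite -expRM_natl ler_expR yE normrN ger0_norm; last by apply: mulr_ge0 => //; apply: mulr_ge0 => //; exact: ltW.
    have z0 := mulr_ge0 (ltW tau0) j0; move: (_%:R) z0 => m z0.
    have -> : alpha * - (2 * tau * m) + eta * (2 * tau * m) = 2 * (eta - alpha) * (tau * m) by ring.
    have -> : m * - (alpha * tau) = - alpha * (tau * m) by ring.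
    by apply: ler_wpM2r => //; lra.
  rewrite big_split /= -mulr_sumr sumr_const card_ord -mulr_natl.
  have := geometric_sum_rev_le J q0 q1 => gs.
  have : B2 * psi * \sum_(i < J) q ^+ (J - i.+1) <= B2 * psi * (1 - q)^-1.
    by apply: ler_wpM2l.
  have : J%:R * Phi <= 4 * l * Phi by apply: ler_wpM2r.
  lra.
have hi : \sum_(i < k) (B2 * psi * expR (alpha * y (J + i).+1 + eta * `|y (J + i).+1|) +
    (if ((J + i).+1 < J)%N then Phi else 0)) <= B2 * psi * (Q / (Q - 1) * Q ^+ k).
  apply: (@le_trans _ _ (\sum_(i < k) (B2 * psi * Q ^+ i.+1))).
    apply: ler_sum => i _; rewrite ltnNge leqW ?leq_addr//= addr0.
    apply: ler_wpM2l; first exact: Bp.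
    have yE : y (J + i).+1 = 2 * tau * i.+1%:R.
      by rewrite /y -addnS natrD; ring.
    rewrite /Q /level_ratio -expRM_natr ler_expR yE ger0_norm; last by apply: mulr_ge0 => //; apply: mulr_ge0 => //; exact: ltW.
    have j0 : 0 <= i.+1%:R :> R by [].
    have := mulr_ge0 (ltW tau0) j0; rewrite /tau; move: (level_step) => u; move: (i.+1%:R) => m z0.
    have -> : alpha * (2 * u * m) + eta * (2 * u * m) = 2 * (alpha + eta) * (u * m) by ring.
    have -> : 2 * (alpha + 1) * u * m = 2 * (alpha + 1) * (u * m) by ring.
    apply: ler_wpM2r => //; lra.
  rewrite -mulr_sumr; apply: ler_wpM2l; first exact: Bp.
  exact: geometric_sum_gt1_le.
apply: (le_trans (lerD lo hi)).
have h1 : 0 <= (B2 * (1 - q)^-1 + 1) * psi.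
  apply: mulr_ge0; last exact: ltW.
  by apply: addr_ge0 => //; apply: mulr_ge0 => //; exact: ltW.
have -> : B * psi * level_ratio ^+ k = (B2 * (1 - q)^-1 + 1) * psi * Q ^+ k +
   B2 * psi * (Q / (Q - 1) * Q ^+ k) by rewrite /B /Q; ring.
by rewrite lerD2r -[leLHS]mulr1; apply: ler_wpM2l.
Qed.

End entropy_levels.

(** * The tail bound for finite families *)

Section chaining_tail.
Context {R : realType} {d : measure_display} {Omega : measurableType d}.
Context (P : probability Omega R).
Context (S : (Omega -> R) -> Prop) (GS : gaussian_space P S).

(** The weights (1 - s) s^k give two geometric series: the entropy has ratio s Q, and the link
    variances, divided by the weights, have ratio 1 / (4 s). Both converge exactly when 1/4 < s <
    1/Q, a nonempty range because the level ratio is less than 4. *)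
Lemma chaining_exponent_le (B psi Q s sigma : R) K :
  0 < sigma -> 0 <= B -> 0 <= psi -> 0 < Q -> 4^-1 < s -> s < Q^-1 -> s < 1 ->
  \sum_(k < K) (1 - s) * s ^+ k * (B * psi * Q ^+ k + B * psi * Q ^+ k.+1 +
     2 * psi / sigma ^+ 4 / 4 ^+ k / ((1 - s) * s ^+ k) ^+ 2) <=
  (B * (1 + Q) * (1 - s) / (1 - s * Q) +
   2 / (sigma ^+ 4 * (1 - s) * (1 - (4 * s)^-1))) * psi.
Proof.
move=> sigma0 B0 psi0 Q0 s4 sQ s1.
have s0 : 0 < s by lra.
have sQ1 : s * Q < 1 by rewrite -ltr_pdivlMr// mul1r.
have i4 : (4 * s)^-1 < 1 by rewrite invf_lt1; lra.
have i40 : 0 <= (4 * s)^-1 by rewrite invr_ge0; lra.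
have sQ0 : 0 <= s * Q by rewrite mulr_ge0// ltW.
have E k : (1 - s) * s ^+ k * (B * psi * Q ^+ k + B * psi * Q ^+ k.+1 +
     2 * psi / sigma ^+ 4 / 4 ^+ k / ((1 - s) * s ^+ k) ^+ 2) =
   (B * (1 + Q) * (1 - s) * psi) * (s * Q) ^+ k +
   (2 * psi / (sigma ^+ 4 * (1 - s))) * (4 * s)^-1 ^+ k.
  rewrite exprVn !exprMn exprS.
  have : s ^+ k != 0 by rewrite expf_neq0// gt_eqF.
  have : 4 ^+ k != 0 :> R by rewrite expf_neq0// gt_eqF.
  have : sigma != 0 by rewrite gt_eqF.
  have : 1 - s != 0 by rewrite gt_eqF// subr_gt0.
  move: (s ^+ k) (4 ^+ k) (Q ^+ k) => u v w h1 h2 h3 h4.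
  by field; rewrite h1 h2 h3 h4.
under eq_bigr do rewrite E.
rewrite big_split /= -!mulr_sumr.
have p1 : 0 <= B * (1 + Q) * (1 - s) * psi.
  by rewrite mulr_ge0// mulr_ge0//; [rewrite mulr_ge0//; lra|lra].
have p2 : 0 <= 2 * psi / (sigma ^+ 4 * (1 - s)).
  by rewrite divr_ge0//; apply: mulr_ge0 => //; [rewrite exprn_ge0// ltW|lra].
have := ler_wpM2l p1 (geometric_sum_le K sQ0 sQ1).
have := ler_wpM2l p2 (geometric_sum_le K i40 i4).
move=> h1 h2; apply: (le_trans (lerD h2 h1)).
rewrite (invfM (sigma ^+ 4 * (1 - s))) le_eqVlt; apply/orP; left; apply/eqP.
by move: (_^-1) (_^-1) (_^-1) => u v w; ring.
Qed.

(** This lets the chain stop: at level [K] the entropy bound already exceeds the size [M] of the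
    family, which can then serve as the last net without entering the constants. *)
Lemma expR_geometric_unbounded (b Q : R) (M : nat) : 0 < b -> 1 < Q ->
  exists K : nat, M%:R <= expR (b * Q ^+ K).
Proof.
move=> b0 Q1; exists (Num.truncn (M%:R / (b * (Q - 1)))).+1.
set K := _.+1.
have bQ : 0 < b * (Q - 1) by rewrite mulr_gt0// subr_gt0.
have : M%:R / (b * (Q - 1)) < K%:R by exact: truncnS_gt.
rewrite ltr_pdivrMr// => MK.
have := ler_wpM2l (ltW b0) (bernoulli_le K (ltW Q1)).
have := expR_ge1Dx (b * Q ^+ K); lra.
Qed.

(** Refinement starts at squared scale r 4^J, above the squared diameter, but the chain starts at r.
    The first J refinements only count the coarsest net of the chain, so they enter through [L 0]
    and not through the weighted series. *)
Lemma chaining_tail (M : nat) (xi : 'I_M -> Omega -> R)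
    (B psi Q s sigma lambda : R) (J : nat) (phi eps : nat -> R) :
  (forall i, S (xi i)) -> (forall i, variance2 P (xi i) <= sigma ^+ 2) ->
  0 < sigma -> 0 < B -> 0 < psi -> 1 < Q -> 4^-1 < s -> s < Q^-1 -> 0 < lambda ->
  (forall n, 0 < eps n) ->
  (forall n, ((expR (- phi n))%:E <= P [set w | forall i, (`|xi i w| <= eps n)%R])%E) ->
  4 * sigma ^+ 2 <= psi / lambda ^+ 2 * 4 ^+ J ->
  (forall k, \sum_(i < J + k) (phi i.+1 + 364 * eps i.+1 ^+ 2 /
      (psi / lambda ^+ 2 * 4 ^+ J / 4 ^+ i.+1)) <= B * psi * Q ^+ k) ->
  (P [set w | exists i, (lambda < xi i w)%R] <=
   (expR (- lambda ^+ 2 / (2 * sigma ^+ 2) +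
     (B + (B * (1 + Q) * (1 - s) / (1 - s * Q) +
       2 / (sigma ^+ 4 * (1 - s) * (1 - (4 * s)^-1)))) * psi))%:E)%E.
Proof.
move=> Sxi vxi sigma0 B0 psi0 Q1 s4 sQ lambda0 eps0 small diam entropy.
have Q0 : 0 < Q by exact: lt_trans Q1.
have s1 : s < 1 by apply: (lt_trans sQ); rewrite invf_lt1.
have s0 : 0 < s by lra.
have [M0|M0] := posnP M.
  rewrite [X in P X](_ : _ = set0) ?measure0 ?lee_fin ?expR_ge0//.
  by rewrite -subset0 => w [i _]; have := ltn_ord i; rewrite [X in (_ < X)%N]M0.
(* Passing through the zero variable bounds a squared distance by 2 sigma^2 + 2 sigma^2. *)
have diam2 i j : dist2 P xi i j <= psi / lambda ^+ 2 * 4 ^+ J.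
  apply: le_trans diam.
  have [S0 _ _ _] := GS.
  apply: (le_trans (var_quasi_triangle GS (Sxi i) S0 (Sxi j))).
  have -> : (fun w => xi i w - 0) = xi i by apply/funext => w; rewrite subr0.
  have -> : (fun w => 0 - xi j w) = (fun w => -1 * xi j w).
    by apply/funext => w; rewrite sub0r mulN1r.
  rewrite (varZ GS)// sqrrN expr1n mul1r.
  have := vxi i; have := vxi j; lra.
have r0 : 0 < psi / lambda ^+ 2 by rewrite divr_gt0// exprn_gt0.
have rJ0 : 0 < psi / lambda ^+ 2 * 4 ^+ J by rewrite mulr_gt0// exprn_gt0.
have /choice[T HT] := nets_exist GS Sxi M0 rJ0 diam2 eps0 small.
have [K MK] := expR_geometric_unbounded M (mulr_gt0 B0 psi0) Q1.
pose N k := if (k < K)%N then T (J + k)%N else [set: 'I_M]%SET.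
have NK : N K = [set: 'I_M]%SET by rewrite /N ltnn.
have wt0 k : 0 < (1 - s) * s ^+ k by rewrite mulr_gt0 ?exprn_gt0 ?subr_gt0.
have wt1 : \sum_(k < K) (1 - s) * s ^+ k <= 1.
  rewrite -mulr_sumr -ler_pdivlMl ?subr_gt0// mulr1.
  by apply: geometric_sum_le => //; exact: ltW.
have net k g : exists2 j, j \in N k & dist2 P xi g j <= psi / lambda ^+ 2 / 4 ^+ k.
  rewrite /N; case: ifP => _; last first.
    by exists g; rewrite ?inE// dist2xx divr_ge0 ?exprn_ge0// ltW.
  have [/(_ g)[j jT gj] _] := HT (J + k)%N; exists j => //.
  apply: (le_trans gj); rewrite exprD (invfM (4 ^+ J)) mulrA.
  by rewrite mulfK// expf_neq0// gt_eqF.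
have card k : (k <= K)%N -> #|N k|%:R <= expR (B * psi * Q ^+ k).
  rewrite leq_eqVlt /N => /orP[/eqP ->|kK].
    by rewrite ltnn cardsT card_ord.
  rewrite kK; have [_ TE] := HT (J + k)%N; apply: (le_trans TE).
  by rewrite ler_expR.
(* This theta minimizes - theta lambda + theta^2 sigma^2 / 2, and it makes theta^2 r equal to psi /
   sigma^4, of the same order as the entropy. *)
have theta0 : 0 < lambda / sigma ^+ 2 by rewrite divr_gt0// exprn_gt0.
have := @chaining _ _ _ _ _ GS _ _ Sxi K N (psi / lambda ^+ 2) (sigma ^+ 2)
  (lambda / sigma ^+ 2) (fun k => B * psi * Q ^+ k) (fun k => (1 - s) * s ^+ k)
  lambda r0 theta0 wt0 wt1 vxi net NK card.
move/le_trans; apply; rewrite lee_fin ler_expR.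
have lam : lambda != 0 by rewrite gt_eqF.
have sig : sigma != 0 by rewrite gt_eqF.
have -> : - (lambda / sigma ^+ 2) * lambda + (lambda / sigma ^+ 2) ^+ 2 * sigma ^+ 2 / 2 =
  - lambda ^+ 2 / (2 * sigma ^+ 2) by field; rewrite sig.
rewrite -[leLHS]addrA lerD2l [leRHS]mulrDl -[Q ^+ 0]/1 [B * psi * 1]mulr1 lerD2l.
apply: le_trans (chaining_exponent_le K sigma0 (ltW B0) (ltW psi0) Q0 s4 sQ s1).
apply: ler_sum => k _.
have -> : 2 * (lambda / sigma ^+ 2) ^+ 2 * (psi / lambda ^+ 2 / 4 ^+ k) =
   2 * psi / sigma ^+ 4 / 4 ^+ k; last by [].
have : 4 ^+ k != 0 :> R by rewrite expf_neq0// gt_eqF.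
by move: (4 ^+ k) => v v0; field; rewrite sig v0 lam.
Qed.

End chaining_tail.

(** * From the Banach space to finite families *)

Section gaussian_vector.
Context {R : realType} {d : measure_display} {Omega : measurableType d}.
Context (P : probability Omega R) (E : completeNormedModType R) (X : Omega -> E).

Lemma dual_elt_lin (a : R) (g h : E -> R) : dual_elt g -> dual_elt h ->
  dual_elt (fun x => a * g x + h x).
Proof.
move=> [gl gc] [hl hc]; split=> [b x y|x].
  by rewrite gl hl; ring.
by apply: cvgD; [apply: cvgM; [exact: cvg_cst|exact: gc]|exact: hc].
Qed.

Lemma measurable_norm_gt (l : R) : Borel_rv X -> measurable [set w | l < `|X w|].
Proof.
move=> BX; apply: (BX [set x | l < `|x|]).
have -> : [set x : E | l < `|x|] = (fun x : E => `|x|) @^-1` [set y | l < y] by [].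
apply: open_comp; last exact: open_gt.
by move=> x _; exact: norm_continuous.
Qed.

Lemma measurable_norm_le (l : R) : Borel_rv X -> measurable [set w | `|X w| <= l].
Proof.
move=> BX; have -> : [set w | `|X w| <= l] = ~` [set w | l < `|X w|].
  by apply/seteqP; split=> w /=; rewrite leNgt => /negP.
by apply: measurableC; exact: measurable_norm_gt.
Qed.

Lemma measurable_dual_elt (g : E -> R) : Borel_rv X -> dual_elt g ->
  measurable_fun setT (g \o X).
Proof.
move=> BX [_ /continuousP gc]; apply: (measurability _ (RGenOpens.measurableE R)).
move=> _ [_ [a [b ->] <-]]; rewrite setTI.
by apply: (BX (g @^-1` `]a, b[%classic)); apply: gc; exact: interval_open.
Qed.

Lemma gaussian_space_dual : centered_gaussian P X ->
  gaussian_space P [set Y | exists2 g : E -> R, dual_elt g & Y = g \o X].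
Proof.
move=> [BX GX]; split.
- exists (fun=> 0) => //; split=> [a x y|x]; last exact: cvg_cst.
  by rewrite mulr0 addr0.
- move=> a _ _ [g dg ->] [h dh ->]; exists (fun x => a * g x + h x) => //.
  exact: dual_elt_lin.
- by move=> _ [g dg ->]; exact: measurable_dual_elt.
- by move=> _ [g dg ->]; exact: GX.
Qed.

Lemma variance_le_weak (sigma : R) (g : E -> R) :
  centered_gaussian P X -> weak_variance P X = (sigma ^+ 2)%:E ->
  dual_elt g -> dual_norm_le1 g -> variance2 P (g \o X) <= sigma ^+ 2.
Proof.
move=> GX wv dg ng; rewrite -lee_fin -wv.
rewrite -(var_integral (gaussian_space_dual GX)); last by exists g.
apply: ereal_sup_ubound; exists g => //=.
by apply: eq_integral => w _; rewrite real_normK// num_real.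
Qed.

End gaussian_vector.

(** The norming sequence makes the event an increasing union over finite families, so a bound
    uniform in [M] passes to the limit by continuity from below. *)
Lemma norm_tail_le (R : realType) (d : measure_display) (Omega : measurableType d)
    (P : probability Omega R) (E : completeNormedModType R) (X : Omega -> E)
    (g : nat -> E -> R) (l : R) (b : \bar R) :
  centered_gaussian P X -> (forall n, dual_elt (g n)) -> (forall n, dual_norm_le1 (g n)) ->
  (forall x, l < `|x| -> exists n, l < g n x) ->
  (forall M, (P [set w | exists i : 'I_M, (l < g i (X w))%R] <= b)%E) ->
  (P [set w | (l < `|X w|)%R] <= b)%E.
Proof.
move=> GX dg ng norming Pb.
pose F M := [set w | exists i : 'I_M, l < g i (X w)].
have FE : [set w | l < `|X w|] = \bigcup_M F M.
  apply/seteqP; split=> w /=.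
    by move=> /norming[n ln]; exists n.+1 => //; exists ord_max.
  move=> [M _ [i li]]; apply: (lt_le_trans li); apply: le_trans (ler_norm _) _.
  exact: ng.
have mF M : measurable (F M).
  apply: (measurable_exceed (gaussian_space_dual GX) (xi := fun i : 'I_M => g i \o X)).
  by move=> i; exists (g i).
have nF : {homo F : n m / (n <= m)%N >-> (n <= m)%O}.
  move=> n m nm; apply/subsetPset => w [i li].
  by exists (widen_ord nm i).
have := nondecreasing_cvg_mu (mu := P) mF (bigcupT_measurable F mF) nF.
rewrite FE => h; rewrite -(cvg_lim _ h)//.
by apply: lime_le; [apply/cvg_ex; eexists; exact: h|apply: nearW => M; exact: Pb].
Qed.

Theorem theorem1p5 (R : realType) (c0 alpha beta sigma : R) :
  0 < c0 -> 0 < alpha -> 0 <= sigma ->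
  exists c1 c2 : R, 0 < c1 /\ 0 < c2 /\
  forall (d : measure_display) (Omega : measurableType d) (P : probability Omega R)
         (E : completeNormedModType R) (X : Omega -> E),
    separable_space E ->
    centered_gaussian P X ->
    (exists eps0 : R, 0 < eps0 /\
       forall eps : R, 0 < eps -> eps < eps0 ->
         (P [set w | (`|X w| <= eps)%R] >=
          (expR (- c0 * eps `^ (- alpha) * `|ln eps| `^ beta))%:E)%E) ->
    weak_variance P X = (sigma ^+ 2)%:E ->
    exists lambda0 : R, forall lambda : R, lambda0 < lambda ->
      (P [set w | (`|X w| > lambda)%R] <=
       (c1 * expR (- lambda ^+ 2 / (2 * sigma ^+ 2)
                   + c2 * lambda `^ (alpha / (alpha + 1))
                        * (ln lambda) `^ (beta / (alpha + 1))))%:E)%E.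
Proof.
move=> c00 a0 sigma_ge0.
have [->|sigma_neq0] := eqVneq sigma 0.
  (* The quotient by 2 sigma^2 = 0 is 0 by convention, so the right-hand side is at least 1. *)
  exists 1, 1; split=> //; split=> // d Omega P E X _ [BX _] _ _.
  exists 0 => lambda _.
  apply: (@le_trans _ _ 1%E).
    by apply: probability_le1; exact: measurable_norm_gt.
  rewrite lee_fin !mul1r expr0n mulr0 invr0 mulr0 add0r -{1}(@expR0 R) ler_expR.
  by rewrite mulr_ge0// powR_ge0.
have sigma0 : 0 < sigma by rewrite lt0r sigma_neq0.
have [B B0 HB] := entropy_levels beta sigma c00 a0.
pose Q := level_ratio alpha.
have Q1 : 1 < Q := level_ratio_gt1 a0.
have Q4 : 4^-1 < Q^-1.
  by rewrite ltf_pV2 ?posrE ?(lt_trans ltr01 Q1)// level_ratio_lt4.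
(* The midpoint of the admissible range of weight ratios; it depends on [alpha] only. *)
pose s := (4^-1 + Q^-1) / 2.
have s4 : 4^-1 < s by rewrite /s; lra.
have sQ : s < Q^-1 by rewrite /s; lra.
have s1 : s < 1 by apply: (lt_trans sQ); rewrite invf_lt1// (lt_trans ltr01 Q1).
have sQ1 : s * Q < 1 by rewrite -ltr_pdivlMr ?mul1r// (lt_trans ltr01 Q1).
have i4 : (4 * s)^-1 < 1 by rewrite invf_lt1; lra.
exists 1, (B + (B * (1 + Q) * (1 - s) / (1 - s * Q) +
   2 / (sigma ^+ 4 * (1 - s) * (1 - (4 * s)^-1)))).
split=> //; split.
  apply: ltr_wpDr => //; apply: addr_ge0.
    apply: divr_ge0; last lra.
    by apply: mulr_ge0; [apply: mulr_ge0; lra|lra].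
  apply: divr_ge0 => //; apply: mulr_ge0; last lra.
  by apply: mulr_ge0; [exact: exprn_ge0|lra].
move=> d Omega P E X sepE GX [eps0 [eps00 small]] wvar.
have [BX _] := GX.
(* Radii cut at exp(- a1) lie below [eps0], and their logarithms have modulus at least 1. *)
pose a1 := Num.max 1 (1 - ln eps0).
have a11 : 1 <= a1 by rewrite le_max lexx.
have a1eps : expR (- a1) < eps0.
  rewrite -[ltRHS]lnK ?posrE// ltr_expR.
  have : 1 - ln eps0 <= a1 by rewrite le_max lexx orbT.
  lra.
have [l0 l01 Hl] := HB a1 a11.
have [g [dg ng norming]] := norming_sequence sepE.
exists (expR l0) => lambda lambda_gt.
have lambda0 : 0 < lambda by apply: lt_trans lambda_gt; exact: expR_gt0.
have ll0 : l0 <= ln lambda by rewrite -[leLHS]expRK ler_ln ?posrE ?expR_gt0// ltW.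
have [psi1 [J [eps [epsP diam entropy]]]] := Hl _ ll0.
rewrite !lnK ?posrE// in diam entropy.
rewrite mul1r -[X in expR (_ + X)]mulrA.
have <- : growth alpha beta (ln lambda) =
  lambda `^ (alpha / (alpha + 1)) * ln lambda `^ (beta / (alpha + 1)).
  by rewrite /growth lnK.
apply: (norm_tail_le GX dg ng (norming^~ lambda)) => M.
have Sxi (i : 'I_M) : [set Y | exists2 h : E -> R, dual_elt h & Y = h \o X] (g i \o X).
  by exists (g i).
apply: (chaining_tail (gaussian_space_dual GX) (xi := fun i : 'I_M => g i \o X)
  (phi := fun n => small_ball_exponent c0 alpha beta (eps n)) Sxi _ sigma0 B0
  (lt_le_trans ltr01 psi1) Q1 s4 sQ lambda0 _ _ diam entropy).
- by move=> i; exact: (variance_le_weak GX wvar).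
- by move=> n; have /andP[] := epsP n.
move=> n; have /andP[en0 en1] := epsP n.
rewrite /small_ball_exponent -!mulNr.
apply: le_trans (small _ en0 (le_lt_trans en1 a1eps)) _.
apply: le_measure; rewrite ?inE.
- exact: measurable_norm_le.
- exact: (measurable_small_ball (gaussian_space_dual GX) Sxi).
by move=> w Xe i; apply: le_trans Xe; exact: ng.
Qed.
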